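(* Let $E$ and $F$ be Banach spaces over $\mathbb{K}$, and let $G$ be a Banach space over $\mathbb{K}$ with an unconditional basis $(g_{i})_{i\in\mathbb{N}}$ and coordinate functionals $(g'_{i})_{i\in\mathbb{N}}\subset G'$. If there exist operators $R\in\mathcal{L}(G;F)$ and $S\in\mathcal{L}(E;G)$ such that $(R(g_{i}))_{i}$ is a seminormalized basic sequence in $F$ and the set $\{S'(g'_{i}): i\in\mathbb{N}\}$ is not relatively compact in $E'$, then, for every $n\in\mathbb{N}$, $\mathcal{P}_{w}(^{n}E;F)$ is not complemented in $\mathcal{P}(^{n}E;F)$.
   Context: $\mathbb{K}$ is $\mathbb{R}$ or $\mathbb{C}$. $E'$ is the dual of $E$, $\mathcal{L}(E;F)$ is the space of bounded linear operators from $E$ into $F$, and $S':G'\to E'$ is the adjoint of $S$. For $n\in\mathbb{N}=\{1,2,\dots\}$, $\mathcal{P}(^{n}E;F)$ is the Banach space of all continuous $n$-homogeneous polynomials from $E$ into $F$, with norm $\|P\|=\sup_{\|x\|\le 1}\|P(x)\|$. $\mathcal{P}_{w}(^{n}E;F)$ is the subspace of all $P\in\mathcal{P}(^{n}E;F)$ which are weakly continuous on bounded sets, that is, for each bounded set $B\subset E$ the restriction $P|_{B}:B\to F$ is continuous when $B$ carries the (relative) weak topology and $F$ the norm topology. A sequence $(x_{i})$ in a Banach space is a seminormalized basic sequence if it is a Schauder basis of its closed linear span and there are constants $a,b$ with $0<a<\|x_{i}\|<b$ for all $i$. A subspace is complemented if it is the range of a bounded linear projection of the whole space. *)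

(* Defs.v *)
From HB Require Import structures.
From mathcomp Require Import all_boot all_order all_algebra.
From mathcomp Require Import complex.
From mathcomp Require Import all_classical all_reals all_analysis.

Set Implicit Arguments.
Unset Strict Implicit.
Unset Printing Implicit Defensive.

Import Order.TTheory GRing.Theory Num.Theory.
Import numFieldNormedType.Exports.

Local Open Scope classical_set_scope.
Local Open Scope ring_scope.

Variant scalar_kind := RealScalars | ComplexScalars.

Definition scalar_field (R : realType) (k : scalar_kind) : numFieldType :=
  match k with
  | RealScalars => R
  | ComplexScalars => R[i]%C
  end.

(* In MathComp the norm of a normed module over K takes its values in K itself,
   so over K = R[i] the supremum below is taken in R[i], for the partial order
   in which x <= y means that y - x is a nonnegative real number. *)
Definition sup_norm (K : numFieldType) (E F : normedModType K) (f : E -> F) : K :=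
  supremum 0 [set `|f x| | x in [set x : E | `|x| <= 1]].

Lemma scalar_field_supremums (R : realType) (k : scalar_kind)
    (A : set (scalar_field R k)) :
  A !=set0 -> (forall x, A x -> 0 <= x) -> ubound A !=set0 ->
  supremums A !=set0.
Proof.
case: k A => /= A [a0 Aa0] Age0 [M AM].
  have supA : has_sup A by split; [exists a0|exists M].
  exists (sup A); split; first exact: sup_upper_bound.
  by move=> b Ab; apply: ge_sup => //; exists a0.
pose B := [set complex.Re x | x in A].
have supB : has_sup B.
  split; first by exists (complex.Re a0), a0.
  by exists (complex.Re M) => _ [x Ax <-]; have := AM _ Ax; rewrite lecE => /andP[].
have ImA x : A x -> complex.Im x = 0 by move=> /Age0; rewrite lecE => /andP[/eqP].
exists (sup B)%:C%C; split.
  move=> x Ax; rewrite lecE /= (ImA _ Ax) eqxx /=.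
  by apply: (sup_upper_bound supB); exists x.
move=> b Ab; have := Ab _ Aa0; rewrite lecE (ImA _ Aa0) => /andP[/eqP b0 _].
rewrite lecE /= b0 eqxx /=; apply: ge_sup; first by exists (complex.Re a0), a0.
by move=> _ [x Ax <-]; have := Ab _ Ax; rewrite lecE => /andP[].
Qed.

Definition bounded_on_unit_ball (K : numFieldType) (E F : normedModType K)
    (f : E -> F) :=
  exists M : K, forall x, `|x| <= 1 -> `|f x| <= M.

Section sup_norm_theory.
Context (R : realType) (k : scalar_kind).
Local Notation K := (scalar_field R k).
Context (E F : normedModType K).
Implicit Types f h : E -> F.

Lemma sup_norm_supremums f : bounded_on_unit_ball f ->
  supremums [set `|f x| | x in [set x : E | `|x| <= 1]] !=set0.
Proof.
move=> [M fM]; apply: scalar_field_supremums.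
- by exists `|f 0|, 0 => //=; rewrite normr0.
- by move=> _ [x _ <-].
- by exists M => _ [x /fM ? <-].
Qed.

Lemma le_sup_norm f x : bounded_on_unit_ball f -> `|x| <= 1 ->
  `|f x| <= sup_norm f.
Proof.
move=> bf x1; have [y Ay] := sup_norm_supremums bf.
rewrite /sup_norm /supremum; case: ifPn => [/eqP A0|_].
  suff : [set `|f x| | x in [set x : E | `|x| <= 1]] `|f x| by rewrite A0.
  by exists x.
by case: xgetP => [z _ [Az _]|/(_ y) //]; apply: Az; exists x.
Qed.

Lemma sup_norm_le f (M : K) : (forall x, `|x| <= 1 -> `|f x| <= M) ->
  sup_norm f <= M.
Proof.
move=> fM; rewrite /sup_norm /supremum; case: ifPn => [/eqP A0|_].
  suff : [set `|f x| | x in [set x : E | `|x| <= 1]] `|f 0| by rewrite A0.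
  by exists 0 => //=; rewrite normr0.
have [|y Ay] := @sup_norm_supremums f; first by exists M.
case: xgetP => [z _ [_ zA]|/(_ y) //].
by apply: zA => _ [x /fM ? <-].
Qed.

Lemma sup_normD f h : bounded_on_unit_ball f -> bounded_on_unit_ball h ->
  sup_norm (f + h) <= sup_norm f + sup_norm h.
Proof.
move=> bf bh; apply: sup_norm_le => x x1.
rewrite (le_trans (ler_normD _ _))// lerD//; exact: le_sup_norm.
Qed.

Lemma bounded_on_unit_ballZ (l : K) f :
  bounded_on_unit_ball f -> bounded_on_unit_ball (l *: f).
Proof.
move=> [M fM]; exists (`|l| * M) => x /fM fxM.
by rewrite normrZ ler_wpM2l.
Qed.

Lemma sup_normZ (l : K) f : bounded_on_unit_ball f ->
  sup_norm (l *: f) = `|l| * sup_norm f.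
Proof.
have le_l a h : bounded_on_unit_ball h -> sup_norm (a *: h) <= `|a| * sup_norm h.
  move=> bh; apply: sup_norm_le => x x1.
  by rewrite normrZ ler_wpM2l// le_sup_norm.
move=> bf; apply/eqP; rewrite eq_le le_l//=.
have [->|l0] := eqVneq l 0.
  rewrite normr0 mul0r (le_trans (normr_ge0 ((0 *: f) 0)))//.
  by apply: le_sup_norm; [exact: bounded_on_unit_ballZ|rewrite normr0].
rewrite -ler_pdivlMl ?normr_gt0// -normfV.
rewrite -[X in sup_norm X <= _](scalerK l0); apply: le_l.
exact: bounded_on_unit_ballZ.
Qed.

Lemma sup_norm_eq0 f : bounded_on_unit_ball f -> sup_norm f = 0 ->
  forall x, `|x| <= 1 -> f x = 0.
Proof.
move=> bf f0 x x1; apply/eqP; rewrite -normr_le0 -f0.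
exact: le_sup_norm.
Qed.

End sup_norm_theory.

Definition is_bounded_op (K : numFieldType) (E F : normedModType K)
    (f : E -> F) :=
  linear f /\ exists M : K, forall x, `|f x| <= M * `|x|.

Definition bounded_op_pred (K : numFieldType) (E F : normedModType K) :
  {pred E -> F} := fun f => `[< is_bounded_op f >].

Record bounded_op (K : numFieldType) (E F : normedModType K) := BoundedOp {
  bounded_op_val :> E -> F ;
  bounded_opP : bounded_op_val \in @bounded_op_pred K E F }.

HB.instance Definition _ (K : numFieldType) (E F : normedModType K) :=
  [isSub for @bounded_op_val K E F].
HB.instance Definition _ (K : numFieldType) (E F : normedModType K) :=
  [Choice of bounded_op E F by <:].

Section bounded_op_lmod.
Context (K : numFieldType) (E F : normedModType K).

Lemma bounded_op_submod_closed : submod_closed (@bounded_op_pred K E F).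
Proof.
split.
  apply/asboolP; split; first by move=> a x y; change (0 = a *: 0 + 0 :> F); rewrite scaler0 addr0.
  by exists 0 => x; rewrite mul0r normr0.
move=> a f h /asboolP[lf [M fM]] /asboolP[lh [N hN]]; apply/asboolP; split.
  move=> b x y.
  change (a *: f (b *: x + y) + h (b *: x + y)
          = b *: (a *: f x + h x) + (a *: f y + h y)).
  rewrite lf lh !scalerDr !scalerA mulrC.
  by rewrite addrACA.
exists (`|a| * M + N) => x; rewrite (le_trans (ler_normD _ _))//.
by rewrite mulrDl lerD// normrZ -mulrA ler_wpM2l.
Qed.

HB.instance Definition _ := GRing.isSubmodClosed.Build K (E -> F)
  (@bounded_op_pred K E F) bounded_op_submod_closed.
HB.instance Definition _ := [SubChoice_isSubLmodule of bounded_op E F by <:].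

Lemma bounded_op_linear (f : bounded_op E F) : linear f.
Proof. by case: f => f /= /asboolP[]. Qed.

HB.instance Definition _ (f : bounded_op E F) :=
  GRing.isLinear.Build K E F *:%R f (bounded_op_linear f).

Lemma bounded_op_le (f : bounded_op E F) :
  exists2 M : K, 0 <= M & forall x, `|f x| <= M * `|x|.
Proof.
case: f => f /= /asboolP[_ [M fM]]; exists `|M| => // x.
have Mx0 := le_trans (normr_ge0 _) (fM x).
by rewrite (le_trans (fM x))// -(ger0_norm Mx0) normrM normr_id.
Qed.

Lemma bounded_op_bounded (f : bounded_op E F) : bounded_on_unit_ball f.
Proof.
have [M M0 fM] := bounded_op_le f; exists M => x x1.
by rewrite (le_trans (fM x))// ler_piMr.
Qed.

End bounded_op_lmod.

Section bounded_op_normed.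
Context (R : realType) (k : scalar_kind).
Local Notation K := (scalar_field R k).
Context (E F : normedModType K).

Lemma bounded_op_normD (f h : bounded_op E F) :
  sup_norm (f + h) <= sup_norm f + sup_norm h.
Proof. by apply: sup_normD; exact: bounded_op_bounded. Qed.

Lemma bounded_op_normZ (l : K) (f : bounded_op E F) :
  sup_norm (l *: f) = `|l| * sup_norm f.
Proof. by apply: sup_normZ; exact: bounded_op_bounded. Qed.

Lemma bounded_op_norm0_eq0 (f : bounded_op E F) : sup_norm f = 0 -> f = 0.
Proof.
move=> f0; apply/val_inj/funext => x /=.
have [->|x0] := eqVneq x 0; first exact: linear0.
have : f (`|x|^-1 *: x) = 0.
  apply: (sup_norm_eq0 (@bounded_op_bounded _ _ _ f) f0).
  by rewrite normrZ normfV normr_id mulVf// normr_eq0.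
rewrite linearZ /= => /eqP; rewrite scaler_eq0 invr_eq0 normr_eq0 (negbTE x0).
by move=> /eqP.
Qed.

HB.instance Definition _ := Lmodule_isNormed.Build K (bounded_op E F)
  bounded_op_normD bounded_op_normZ bounded_op_norm0_eq0.

End bounded_op_normed.

Definition dual (K : numFieldType) (E : normedModType K) := bounded_op E K^o.

HB.instance Definition _ (K : numFieldType) (E : normedModType K) :=
  GRing.Lmodule.on (dual E).
HB.instance Definition _ (R : realType) (k : scalar_kind)
  (E : normedModType (scalar_field R k)) := NormedModule.on (dual E).

Lemma adjoint_subproof (K : numFieldType) (E G : normedModType K)
    (S : bounded_op E G) (phi : dual G) :
  (fun x : E => phi (S x)) \in @bounded_op_pred K E K^o.
Proof.
have [M M0 SM] := bounded_op_le S; have [N N0 phiN] := bounded_op_le phi.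
apply/asboolP; split; first by move=> a x y; rewrite !linearP.
exists (N * M) => x; rewrite (le_trans (phiN _))//.
by rewrite -mulrA ler_wpM2l.
Qed.

Definition adjoint (K : numFieldType) (E G : normedModType K)
    (S : bounded_op E G) (phi : dual G) : dual E :=
  BoundedOp (adjoint_subproof S phi).

Definition weak_space (K : numFieldType) (E : normedModType K) : Type :=
  sup_topology (fun phi : dual E =>
    Topological.class (initial_topology (phi : E -> K^o))).

HB.instance Definition _ (K : numFieldType) (E : normedModType K) :=
  Topological.on (weak_space E).

Definition multilinear (K : numFieldType) (n : nat) (E F : lmodType K)
    (A : ('I_n -> E) -> F) :=
  forall (x : 'I_n -> E) (i : 'I_n) (a : K) (u v : E),
    A [eta x with i |-> a *: u + v] =
    a *: A [eta x with i |-> u] + A [eta x with i |-> v].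

Definition homogeneous_polynomial (K : numFieldType) (n : nat)
    (E F : lmodType K) (P : E -> F) :=
  exists2 A : ('I_n -> E) -> F, multilinear A & forall x, P x = A (fun=> x).

Definition hpoly_pred (K : numFieldType) (n : nat) (E F : normedModType K) :
  {pred E -> F} := fun P => `[< homogeneous_polynomial n P /\ continuous P >].

Record hpoly (K : numFieldType) (n : nat) (E F : normedModType K) := HPoly {
  hpoly_val :> E -> F ;
  hpolyP : hpoly_val \in @hpoly_pred K n E F }.

HB.instance Definition _ (K : numFieldType) n (E F : normedModType K) :=
  [isSub for @hpoly_val K n E F].
HB.instance Definition _ (K : numFieldType) n (E F : normedModType K) :=
  [Choice of hpoly n E F by <:].

Section hpoly_lmod.
Context (K : numFieldType) (n : nat) (E F : normedModType K).

Lemma hpoly_submod_closed : submod_closed (@hpoly_pred K n E F).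
Proof.
split.
  apply/asboolP; split; last by move=> x; exact: cvg_cst.
  by exists (fun=> 0) => // x i a u v; rewrite scaler0 addr0.
move=> a P Q /asboolP[[A mA PA] cP] /asboolP[[B mB QB] cQ].
apply/asboolP; split.
  exists (fun x => a *: A x + B x) => [x i b u v|x].
    by rewrite mA mB !scalerDr !scalerA mulrC addrACA.
  by rewrite !fctE PA QB.
by move=> x; apply: cvgD; [apply: cvgZr; exact: cP|exact: cQ].
Qed.

HB.instance Definition _ := GRing.isSubmodClosed.Build K (E -> F)
  (@hpoly_pred K n E F) hpoly_submod_closed.
HB.instance Definition _ := [SubChoice_isSubLmodule of hpoly n E F by <:].

Lemma hpoly_continuous (P : hpoly n E F) : continuous P.
Proof. by case: P => P /= /asboolP[]. Qed.

Lemma hpolyZ (P : hpoly n E F) (a : K) x : P (a *: x) = a ^+ n *: P x.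
Proof.
case: P => P /= /asboolP[[A mA PA] _]; rewrite !PA.
pose y m : 'I_n -> E := fun i => if (i < m)%N then a *: x else x.
have Ay m : (m <= n)%N -> A (y m) = a ^+ m *: A (fun=> x).
  elim: m => [|m IH] mn; first by rewrite expr0 scale1r.
  pose i := Ordinal mn.
  have A0 z : A [eta z with i |-> 0] = 0.
    have := mA z i 1 0 0; rewrite !scale1r addr0.
    by move/eqP; rewrite -subr_eq0 opprD addNKr oppr_eq0 => /eqP.
  have -> : y m.+1 = [eta y m with i |-> a *: x + 0].
    apply/funext => j /=; rewrite addr0 /y ltnS leq_eqVlt -val_eqE /=.
    by case: eqP.
  rewrite mA A0 addr0.
  have -> : [eta y m with i |-> x] = y m :> ('I_n -> E).
    apply/funext => j /=; case: eqP => // ->.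
    by rewrite /y ltnn.
  by rewrite IH ?(ltnW mn)// scalerA exprS.
rewrite -Ay//; congr A; apply/funext => j.
by rewrite /y ltn_ord.
Qed.

Lemma hpoly_bounded (P : hpoly n E F) : bounded_on_unit_ball P.
Proof.
have /cvgrPdist_lt/(_ _ ltr01)/nbhs_norm0P[e /= e0 Pe] :=
  @hpoly_continuous P 0.
pose a := e / 2; have a0 : 0 < a by rewrite divr_gt0.
exists ((a ^+ n)^-1 * (`|P 0| + 1)) => x x1.
have an0 : 0 < a ^+ n by rewrite exprn_gt0.
rewrite ler_pdivlMl// -[X in X * _ <= _](gtr0_norm an0) -normrZ -hpolyZ.
have /Pe Pax : `|a *: x| < e.
  rewrite normrZ gtr0_norm// (@le_lt_trans _ _ a)//.
    by rewrite ler_piMr// ltW.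
  by rewrite /a ltr_pdivrMr// ltr_pMr// ltr1n.
rewrite -[P (a *: x)](subKr (P 0)) (le_trans (ler_normB _ _))//.
by rewrite lerD2l ltW.
Qed.

End hpoly_lmod.

Section hpoly_normed.
Context (R : realType) (k : scalar_kind).
Local Notation K := (scalar_field R k).
Context (n : nat) (E F : normedModType K).

Lemma hpoly_normD (P Q : hpoly n E F) :
  sup_norm (P + Q) <= sup_norm P + sup_norm Q.
Proof. by apply: sup_normD; exact: hpoly_bounded. Qed.

Lemma hpoly_normZ (l : K) (P : hpoly n E F) :
  sup_norm (l *: P) = `|l| * sup_norm P.
Proof. by apply: sup_normZ; exact: hpoly_bounded. Qed.

Lemma hpoly_norm0_eq0 (P : hpoly n E F) : sup_norm P = 0 -> P = 0.
Proof.
move=> P0; apply/val_inj/funext => x /=.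
have Px0 y : `|y| <= 1 -> P y = 0.
  by apply: (sup_norm_eq0 (@hpoly_bounded _ _ _ _ P) P0).
have [->|x0] := eqVneq x 0; first by rewrite Px0// normr0.
have nx0 : `|x| != 0 by rewrite normr_eq0.
rewrite -[x](scalerKV nx0) hpolyZ Px0 ?scaler0//.
by rewrite normrZ normfV normr_id mulVf.
Qed.

HB.instance Definition _ := Lmodule_isNormed.Build K (hpoly n E F)
  hpoly_normD hpoly_normZ hpoly_norm0_eq0.

End hpoly_normed.

(* B has to be a set of the weak space: the topology used in {within B, _} is
   determined by the type of B, not by that of the function. *)
Definition weakly_continuous_on_bounded (K : numFieldType)
    (E F : normedModType K) (f : E -> F) :=
  forall B : set (weak_space E), bounded_set (B : set E) ->
    {within B, continuous (f : weak_space E -> F)}.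

Definition hpoly_w (K : numFieldType) (n : nat) (E F : normedModType K) :
    set (hpoly n E F) :=
  [set P | weakly_continuous_on_bounded P].

Definition complemented (R : realType) (k : scalar_kind)
    (V : normedModType (scalar_field R k)) (M : set V) :=
  exists2 p : bounded_op V V, (forall v, p (p v) = p v) & range p = M.

Section bases.
Context (K : numFieldType) (X : normedModType K).
Implicit Types (V : set X) (x : nat -> X).

Definition schauder_basis_of V x :=
  (forall i, V (x i)) /\
  forall v, V v ->
    exists! a : nat -> K, series (fun i => a i *: x i) @ \oo --> v.

Definition linear_span x : set X :=
  [set y | exists (m : nat) (a : nat -> K), y = \sum_(i < m) a i *: x i].

Definition basic_sequence x := schauder_basis_of (closure (linear_span x)) x.

Definition seminormalized x :=
  exists a b : K, 0 < a /\ forall i, a < `|x i| < b.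

Definition unconditionally_convergent (u : nat -> X) :=
  forall s : nat -> nat, bijective s -> cvgn (series (u \o s)).

Definition unconditional_basis x :=
  schauder_basis_of setT x /\
  forall a : nat -> K, cvgn (series (fun i => a i *: x i)) ->
    unconditionally_convergent (fun i => a i *: x i).

Definition coordinate_functionals x (x' : nat -> dual X) :=
  forall (v : X) (a : nat -> K),
    series (fun i => a i *: x i) @ \oo --> v -> forall i, x' i v = a i.

End bases.

(* Main.v *)
(*
Let phi_i = S'(g'_i). Since the g_i are bounded below, phi_i tends to 0
pointwise, so if the phi_i are not relatively compact there are infinitely many
i with points z_i of a fixed ball such that phi_i(z_i) = 1. Unconditionality
gives uniformly bounded projections P_A of G onto the span of the g_i, i in A,
and, for phi one of the phi_i, polynomials U_A(x) = phi(x)^(n-1) T P_A S x,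
which are weakly continuous on bounded sets when A is finite. Let p be a
projection onto the weakly continuous polynomials. Extend the coordinate
functionals of the basic sequence (T g_j), by Hahn-Banach, to uniformly bounded
real-linear f_j on F. For fixed x and j the set function
A |-> f_j((U_A - p U_A)(x)) is bounded, finitely additive and null on finite
sets, so it is null on all but countably many members of an uncountable almost
disjoint family of infinite sets. Hence some infinite A is null for countably
many pairs (x, j) at once: on the points x = x0 + z_i - z_j, where phi(x0) = 1,
the weakly continuous polynomial Q = p U_A has the coordinates of U_A. But
x0 + z_i - z_j tends weakly to x0 along an ultrafilter, whereas the i-th
coordinate of Q(x0 + z_i - z_j) stays near 1 and that of Q(x0) tends to 0.
*)
Require Import Defs.
From mathcomp Require Import all_boot all_order all_algebra.
From mathcomp Require Import complex.
From mathcomp Require Import all_classical all_reals all_analysis.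
From mathcomp Require Import ring lra.

Set Implicit Arguments.
Unset Strict Implicit.
Unset Printing Implicit Defensive.

Import Order.TTheory GRing.Theory Num.Theory.
Import numFieldNormedType.Exports.

Local Open Scope classical_set_scope.
Local Open Scope ring_scope.

(** * Real and complex scalars *)

Section scalars.
Context (R : realType) (k : scalar_kind).
Local Notation K := (scalar_field R k).

Definition scalar_re : K -> R :=
  match k return scalar_field R k -> R with
  | RealScalars => id
  | ComplexScalars => @complex.Re R
  end.

Definition scalar_inj : R -> K :=
  match k return R -> scalar_field R k with
  | RealScalars => id
  | ComplexScalars => fun a => a%:C%C
  end.

Lemma scalar_inj1 : scalar_inj 1 = 1. Proof. by rewrite /scalar_inj; case: k. Qed.

Lemma scalar_injD : {morph scalar_inj : a b / a + b}.
Proof. by rewrite /scalar_inj; case: k => //= a b; rewrite rmorphD. Qed.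

Lemma scalar_inj0 : scalar_inj 0 = 0.
Proof. by rewrite /scalar_inj; case: k. Qed.

Lemma scalar_injM : {morph scalar_inj : a b / a * b}.
Proof. by rewrite /scalar_inj; case: k => //= a b; rewrite rmorphM. Qed.

Lemma scalar_reD : {morph scalar_re : x y / x + y}.
Proof. by rewrite /scalar_re; case: k => //= -[? ?] [? ?]. Qed.

Lemma scalar_re0 : scalar_re 0 = 0.
Proof. by rewrite /scalar_re; case: k. Qed.

Lemma scalar_re1 : scalar_re 1 = 1.
Proof. by rewrite /scalar_re; case: k. Qed.

Lemma scalar_re_injM a x : scalar_re (scalar_inj a * x) = a * scalar_re x.
Proof.
by move: x; rewrite /scalar_re /scalar_inj; case: k => //= -[? ?] /=;
  rewrite mul0r subr0.
Qed.

Lemma scalar_reK a : scalar_re (scalar_inj a) = a.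
Proof. by rewrite -[scalar_inj a]mulr1 scalar_re_injM scalar_re1 mulr1. Qed.

Lemma scalar_inj_ge0 a : (0 <= scalar_inj a) = (0 <= a).
Proof. by rewrite /scalar_inj; case: k => //=; rewrite ler0c. Qed.

Lemma le_scalar_re x y : x <= y -> scalar_re x <= scalar_re y.
Proof.
by move: x y; rewrite /scalar_re; case: k => //= x y; rewrite lecE => /andP[].
Qed.

Lemma scalar_re_norm (x : K) : scalar_inj (scalar_re `|x|) = `|x|.
Proof.
by move: x; rewrite /scalar_re /scalar_inj; case: k => //= x; rewrite normc_def.
Qed.

Lemma scalar_reKnorm (E : normedModType K) (x : E) :
  scalar_inj (scalar_re `|x|) = `|x|.
Proof. by rewrite -[X in scalar_re X]ger0_norm // scalar_re_norm ger0_norm. Qed.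

Lemma norm_scalar_re_le x : `|scalar_re x| <= scalar_re `|x|.
Proof.
move: x; rewrite /scalar_re; case: k => //= x.
by have := normc_ge_Re x; rewrite lecE => /andP[].
Qed.

Lemma scalar_archi (x : K) : 0 <= x -> exists n : nat, x < n%:R.
Proof.
move: x; case: k => /= x x0.
  by exists (Num.truncn x).+1; exact: truncnS_gt.
exists (Num.truncn (complex.Re x)).+1; rewrite ltcE.
move: x0; rewrite lecE => /andP[/eqP -> _].
rewrite -(rmorph_nat (real_complex R)) /= eqxx /=; exact: truncnS_gt.
Qed.

(** The image of an ultrafilter is again an ultrafilter, and it converges because it contains a
    subset of the compact segment from [- M] to [M]. *)
Lemma real_ultra_cvg T (W : set_system T) (u : T -> R) (M : R) :
  UltraFilter W -> (\forall t \near W, `|u t| <= M) ->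
  exists l : R, u @ W --> l.
Proof.
move=> UW uM; have := @segment_compact R (- M) M.
rewrite compact_ultra => /(_ (u @ W)).
case.
- have PW : ProperFilter (u @ W) by exact: fmap_proper_filter.
  split=> // G PG sG; apply/seteqP; split; last exact: sG.
  move=> A GA; have [WA|WA] := in_ultra_setVsetC (u @^-1` A) UW; first exact: WA.
  have : G (A `&` ~` A) by apply: filterI => //; exact: sG.
  by rewrite setICr => /filter_not_empty.
- by apply: filterS uM => t /=; rewrite in_itv /= -ler_norml.
- by move=> l [_ ?]; exists l.
Qed.

Definition scalar_im : K -> R :=
  match k return scalar_field R k -> R with
  | RealScalars => fun=> 0
  | ComplexScalars => @complex.Im R
  end.

Definition scalar_of_re_im (a b : R) : K :=
  match k return scalar_field R k with
  | RealScalars => a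
  | ComplexScalars => Complex a b
  end.

Lemma norm_scalar_im_le x : `|scalar_im x| <= scalar_re `|x|.
Proof.
move: x; rewrite /scalar_re /scalar_im; case: k => //= x; first by rewrite normr0.
by case: x => a b /=; rewrite -sqrtr_sqr ler_wsqrtr// lerDr sqr_ge0.
Qed.

Lemma norm_scalar_sub_le a b x :
  scalar_re `|scalar_of_re_im a b - x| <=
  `|a - scalar_re x| + `|b - scalar_im x|.
Proof.
have ReIm (z : R[i]) : complex.Re `|z| <= `|complex.Re z| + `|complex.Im z|.
  rewrite -lecR RRe_real ?normr_real// [X in `|X| <= _]complexE.
  rewrite (le_trans (ler_normD _ _))// rmorphD normrM !normc_def/=.
  by rewrite !expr0n/= !addr0 add0r expr1n sqrtr1 mul1r !sqrtr_sqr.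
move: x; rewrite /scalar_re /scalar_im /scalar_of_re_im; case: k => [x|[c d]].
  by rewrite lerDl.
exact: (ReIm (Complex (a - c) (b - d))).
Qed.

Lemma lt_scalar_inj (x : K) a : x \is Num.real -> (x < scalar_inj a) = (scalar_re x < a).
Proof.
by move: x; rewrite /scalar_re /scalar_inj; case: k => //= x xr; rewrite -ltcR RRe_real.
Qed.

Lemma scalar_injK (x : K) : x \is Num.real -> scalar_inj (scalar_re x) = x.
Proof.
by move: x; rewrite /scalar_re /scalar_inj; case: k => //= x xr; rewrite RRe_real.
Qed.

Lemma scalar_re_gt0 (x : K) : 0 < x -> 0 < scalar_re x.
Proof.
by move: x; rewrite /scalar_re; case: k => //= x; rewrite ltcE => /andP[].
Qed.

(** Real and imaginary parts are bounded by the norm, so each converges by the real case. *)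
Lemma scalar_ultra_cvg T (W : set_system T) (u : T -> K) (M : K) :
  UltraFilter W -> (\forall t \near W, `|u t| <= M) ->
  exists l : K, u @ W --> l.
Proof.
move=> UW uM.
have [|a ua] := @real_ultra_cvg T W (scalar_re \o u) (scalar_re M) UW.
  by apply: filterS uM => t /le_scalar_re; exact/le_trans/norm_scalar_re_le.
have [|b ub] := @real_ultra_cvg T W (scalar_im \o u) (scalar_re M) UW.
  by apply: filterS uM => t /le_scalar_re; exact/le_trans/norm_scalar_im_le.
exists (scalar_of_re_im a b); apply/cvgrPdist_lt => /= e e0.
have e20 : 0 < scalar_re e / 2 by rewrite divr_gt0// scalar_re_gt0.
move/cvgrPdist_lt : ua => /(_ _ e20) ua; move/cvgrPdist_lt : ub => /(_ _ e20) ub.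
near=> t; rewrite -[e]scalar_injK ?gtr0_real// lt_scalar_inj ?normr_real//.
rewrite (le_lt_trans (norm_scalar_sub_le _ _ _))// [ltRHS]splitr ltrD//.
  by near: t.
by near: t.
Unshelve. all: by end_near. Qed.

End scalars.

(** * The Hahn-Banach theorem *)

Section hahn_banach.
Context (R : realType) (k : scalar_kind).
Local Notation K := (scalar_field R k).
Local Notation inj := (@scalar_inj R k).
Context (V : lmodType K) (p : V -> R).
Hypothesis p_subadditive : forall x y, p (x + y) <= p x + p y.
Hypothesis p_homogeneous : forall a x, 0 <= a -> p (inj a *: x) = a * p x.

(** Partial real-linear functionals are encoded by their graphs, so that a chain is joined by a
    union; single-valuedness follows from the domination by [p]. *)
Definition dominated_real_linear_graph (G : set (V * R)) :=
  [/\ G (0, 0), forall a x y, G x -> G y ->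
        G (inj a *: x.1 + y.1, a * x.2 + y.2)
    & forall x, G x -> x.2 <= p x.1].

Let p0 : p 0 = 0.
Proof. by rewrite -[0 in LHS](scaler0 _ (inj 0)) p_homogeneous ?mul0r. Qed.

Let injN1 : inj (-1) = -1.
Proof.
apply: (addrI (inj 1)); rewrite -scalar_injD scalar_inj1 !subrr.
by apply: (addrI (inj 0)); rewrite -scalar_injD !addr0.
Qed.

(** The difference of two values at [x] is a value at 0, hence at most [p 0 = 0], in both orders. *)
Lemma dominated_graph_functional G x r s :
  dominated_real_linear_graph G -> G (x, r) -> G (x, s) -> r = s.
Proof.
move=> [G0 Glin Gp].
have le t u : G (x, t) -> G (x, u) -> t <= u.
  move=> Gt Gu; have /= := Gp _ (Glin (-1) _ _ Gu Gt).
  by rewrite /= injN1 scaleN1r addNr p0 mulN1r addrC subr_le0.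
by move=> Gr Gs; apply/eqP; rewrite eq_le !le.
Qed.

(** The value at [v] has to lie above every [x.2 - p (x.1 - v)] and below every [p (y.1 + v) - y.2].
    Subadditivity puts the former below the latter, and [c] is the supremum of the former. Multiples
    of [v] follow by positive homogeneity, separately for each sign of [t]. *)
Lemma dominated_graph_extend G v : dominated_real_linear_graph G ->
  exists c : R, dominated_real_linear_graph
    [set z | exists2 x, G x & exists t : R, z = (x.1 + inj t *: v, x.2 + t * c)].
Proof.
move=> [G0 Glin Gp].
have addG x y : G x -> G y -> G (x.1 + y.1, x.2 + y.2).
  by move=> Gx Gy; have := Glin 1 _ _ Gx Gy; rewrite scalar_inj1 scale1r mul1r.
have scaleG a x : G x -> G (inj a *: x.1, a * x.2).
  by move=> Gx; have := Glin a _ _ Gx G0; rewrite !addr0.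
pose L := [set x.2 - p (x.1 - v) | x in G].
have LU x y : G x -> G y -> x.2 - p (x.1 - v) <= p (y.1 + v) - y.2.
  move=> Gx Gy; have := Gp _ (addG _ _ Gx Gy); rewrite /= => xyp.
  have := p_subadditive (x.1 - v) (y.1 + v).
  by rewrite addrACA addNr addr0; lra.
have supL : has_sup L.
  split; first by exists ((0 : R) - p (0 - v)), (0, 0).
  by exists (p (0 + v) - 0) => _ [x Gx <-]; exact: (LU _ (0, 0)).
exists (sup L); split.
- by exists (0, 0) => //; exists 0; rewrite /= mul0r scalar_inj0 scale0r !addr0.
- move=> a _ _ [x Gx [s ->]] [y Gy [t ->]]; exists (inj a *: x.1 + y.1, a * x.2 + y.2).
    exact: Glin.
  exists (a * s + t) => /=; congr pair.
    by rewrite scalerDr scalar_injD scalar_injM scalerDl scalerA addrACA.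
  by ring.
have up x : G x -> x.2 + sup L <= p (x.1 + v).
  move=> Gx; suff : sup L <= p (x.1 + v) - x.2 by lra.
  by apply: ge_sup => [|_ [y Gy <-]]; [case: supL | exact: LU].
have down x : G x -> x.2 - sup L <= p (x.1 - v).
  move=> Gx; suff : x.2 - p (x.1 - v) <= sup L by lra.
  by apply: (sup_upper_bound supL); exists x.
move=> _ [x Gx [t ->]] /=.
have [t0|t0|->] := ltgtP t 0.
- have Nt0 : 0 < - t by rewrite oppr_gt0.
  have := down _ (scaleG (- t)^-1 _ Gx); rewrite -(ler_pM2l Nt0)/=.
  rewrite -(p_homogeneous _ (ltW Nt0)) scalerBr scalerA -scalar_injM.
  rewrite divff ?gt_eqF// scalar_inj1 scale1r mulrBr mulrA divff ?gt_eqF// mul1r.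
  rewrite -scaleNr mulNr opprK; congr (_ <= p (_ + _ *: _)).
  by rewrite -[- t]mulN1r scalar_injM injN1 mulN1r opprK.
- have := up _ (scaleG t^-1 _ Gx); rewrite -(ler_pM2l t0)/=.
  rewrite -(p_homogeneous _ (ltW t0)) scalerDr scalerA -scalar_injM.
  by rewrite divff ?gt_eqF// scalar_inj1 scale1r mulrDr mulrA divff ?gt_eqF// mul1r.
- by rewrite mul0r scalar_inj0 scale0r !addr0 Gp.
Qed.

(** Zorn's lemma gives a maximal dominated graph, and the one-step extension shows that it is
    defined everywhere. The functional is only real-linear, which treats both scalar fields
    alike. *)
Theorem hahn_banach (G0 : set (V * R)) : dominated_real_linear_graph G0 ->
  exists f : V -> R,
    [/\ forall x y, f (x + y) = f x + f y,
        forall a x, f (inj a *: x) = a * f x,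
        forall x, f x <= p x
      & forall x, G0 x -> f x.1 = x.2].
Proof.
move=> dG0.
(* Zorn_bigcup also applies its hypothesis to the empty chain, whose union is
   empty, hence the condition on [G `|` G0] rather than on [G]. *)
pose P (G : set (V * R)) := dominated_real_linear_graph (G `|` G0).
have [F FP Ftot|G [PG Gmax]] := @Zorn_bigcup (V * R)%type P.
  have chain x y : ((\bigcup_(X in F) X) `|` G0) x ->
      ((\bigcup_(X in F) X) `|` G0) y -> exists2 H, (P H \/ H = G0) &
      [/\ (H `|` G0) x, (H `|` G0) y & H `|` G0 `<=` (\bigcup_(X in F) X) `|` G0].
    have sub X : F X -> X `|` G0 `<=` (\bigcup_(X in F) X) `|` G0.
      by move=> FX z [Xz|]; [left; exists X|right].
    move=> [[X FX Xx]|Gx] [[Y FY Yy]|Gy].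
    - have [XY|YX] := Ftot _ _ FX FY.
        by exists Y; [left; exact: FP|split; [left; exact: XY|left|exact: sub]].
      by exists X; [left; exact: FP|split; [left|left; exact: YX|exact: sub]].
    - by exists X; [left; exact: FP|split; [left|right|exact: sub]].
    - by exists Y; [left; exact: FP|split; [right|left|exact: sub]].
    - by exists G0; [right|split; [right|right|move=> z []; right]].
  have PH H : P H \/ H = G0 -> dominated_real_linear_graph (H `|` G0).
    by move=> [//|->]; rewrite setUid.
  split.
  - by right; case: dG0.
  - move=> a x y Ux Uy; have [H /PH[_ Hlin _] [Hx Hy]] := chain _ _ Ux Uy.
    by apply; exact: Hlin.
  - move=> x Ux; have [H /PH[_ _ Hp] [Hx _ _]] := chain _ _ Ux Ux.
    exact: Hp.
have total v : exists r, (G `|` G0) (v, r).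
  have [c dG'] := dominated_graph_extend v PG.
  set G' := [set z | _] in dG'.
  have GG' : G `|` G0 `<=` G'.
    by move=> x Gx; exists x => //; exists 0; rewrite mul0r scalar_inj0 scale0r !addr0;
      case: x Gx.
  (* If [(v, c)] were missing, [G'] would be strictly larger than [G], against maximality. *)
  exists c; apply: contrapT => Gvc; apply: (Gmax G').
    split; first by move=> x Gx; apply: GG'; left.
    move=> G'G; apply: Gvc; left; apply: G'G.
    exists (0, 0); first by case: PG.
    by exists 1; rewrite scalar_inj1 scale1r mul1r !add0r.
  rewrite /P; suff -> : G' `|` G0 = G' by [].
  by apply/setUidPl => x Gx; apply: GG'; right.
have [f Gf] := choice total; exists f; have [G00 Glin Gp] := PG.
have Gfun x r : (G `|` G0) (x, r) -> f x = r.
  by move=> Gr; exact: (dominated_graph_functional PG (Gf x) Gr).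
split=> [x y|a x|x|[x r] Gx].
- by apply: Gfun; have := Glin 1 _ _ (Gf x) (Gf y); rewrite /= scalar_inj1 scale1r mul1r.
- by apply: Gfun; have := Glin a _ _ (Gf x) G00; rewrite /= !addr0.
- exact: (Gp _ (Gf x)).
- by apply: Gfun; right.
Qed.
End hahn_banach.

(** * Baire category and the basis constant *)

Lemma cvg_dist_le (K : numFieldType) (V : pseudoMetricNormedZmodType K) (T : Type)
    (W : set_system T) (u : T -> V) (l y : V) (b : K) :
  ProperFilter W -> u @ W --> l -> (\forall t \near W, `|u t - y| <= b) ->
  `|l - y| <= b.
Proof.
move=> PW ul ub; apply/ler_addgt0Pr => e e0.
have /cvgrPdist_le/(_ _ e0) ue := ul.
have [t [lt tb]] := filter_ex (filterI ue ub).
rewrite -(subrKA (u t)) (le_trans (ler_normD _ _))// addrC.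
by rewrite lerD.
Qed.

Section baire.
Context (R : realType) (k : scalar_kind).
Local Notation K := (scalar_field R k).

Lemma exists_inv_pow2_lt (e : K) : 0 < e -> exists n, 2 ^- n < e.
Proof.
move=> e0; have [|n en] := @scalar_archi R k e^-1; first by rewrite invr_ge0 ltW.
exists n; rewrite -[e]invrK ltf_pV2 ?posrE ?exprn_gt0 ?invr_gt0//.
by rewrite (lt_trans en)// -natrX ltr_nat ltn_expl.
Qed.

Lemma exists_pos_lt2 (s t : K) : 0 < s -> 0 < t ->
  exists u, [/\ 0 < u, u <= s & u <= t].
Proof.
move=> s0 t0; have st0 : 0 < s + t by rewrite addr_gt0.
(* The order of [K] is only partial in the complex case; this explicit lower bound stands in for a
   minimum. *)
exists (s * t / (s + t)); split; first by rewrite !mulr_gt0// invr_gt0.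
  by rewrite ler_pdivrMr// ler_pM2l// lerDr ltW.
by rewrite ler_pdivrMr// mulrC ler_pM2l// lerDl ltW.
Qed.

Context (X : completeNormedModType K).

(** Baire's argument inside [V]: if every [C n] were nowhere dense in [V], nested balls with the
    n-th one avoiding [C n] would shrink to a point of [V] in no [C n]. *)
Lemma baire_closed_cover (V : set X) (C : nat -> set X) (v0 : X) :
  closed V -> V v0 -> V `<=` \bigcup_n C n ->
  exists n v r, [/\ V v, 0 < r &
    forall w, V w -> `|w - v| < r -> closure (C n) w].
Proof.
move=> clV Vv0 VC; apply: contrapT => nC.
(* A pair is a centre and a radius. The new closed ball lies in the old one, has at most half its
   radius and misses [C n]. *)
pose P n (vr ws : X * K) := [/\ V ws.1, 0 < ws.2, `|ws.1 - vr.1| + ws.2 <= vr.2,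
  ws.2 <= vr.2 / 2 & forall z, `|z - ws.1| <= ws.2 -> ~ C n z].
have step (nvr : nat * (X * K)) : exists ws, V nvr.2.1 -> 0 < nvr.2.2 ->
    P nvr.1 nvr.2 ws.
  case: nvr => n [v r] /=.
  have [[Vv r0]|h] := pselect (V v /\ 0 < r); last first.
    by exists (v, r) => Vv r0; case: h.
  have [w [Vw wv /existsNP[B /not_implyP[/nbhs_ballP[s /= s0 sB]]]]] :
      exists w, [/\ V w, `|w - v| < r & ~ closure (C n) w].
    apply: contrapT => h; apply: nC; exists n, v, r; split=> // w Vw wv.
    by apply: contrapT => Cw; apply: h; exists w.
  move=> /set0P/negP/negPn/eqP CB.
  have [t [t0 ts tr]] :=
    exists_pos_lt2 (divr_gt0 s0 (ltr0Sn _ 1)) (divr_gt0 r0 (ltr0Sn _ 1)).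
  have rwv : 0 < r - `|w - v| by rewrite subr_gt0.
  have [u [u0 ut ur]] := exists_pos_lt2 t0 rwv.
  exists (w, u) => _ _; split=> //=.
  - by rewrite addrC -lerBrDr.
  - exact: le_trans tr.
  - move=> z zw Cz; suff : (C n `&` B) z by rewrite CB.
    split=> //; apply: sB; rewrite -ball_normE /= distrC (le_lt_trans zw)//.
    by rewrite (le_lt_trans ut)// (le_lt_trans ts)// ltr_pdivrMr// ltr_pMr// ltr1n.
have [f Pf] := choice step.
pose fix b n := if n is m.+1 then f (m, b m) else (v0, 1).
have Vb n : V (b n).1 /\ 0 < (b n).2.
  elim: n => [|n [Vn rn]] /=; first by split.
  by have [] := Pf (n, b n) Vn rn.
have Pb n : P n (b n) (b n.+1) by have [Vn rn] := Vb n; exact: (Pf (n, b n)).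
have rb n : (b n).2 <= 2 ^- n.
  elim: n => [|n IH]; first by rewrite expr0 invr1.
  have [_ _ _ + _] := Pb n; move=> /le_trans; apply.
  by rewrite exprSr invfM ler_pM2r.
have bb n m : `|(b (n + m)%N).1 - (b n).1| + (b (n + m)%N).2 <= (b n).2.
  elim: m => [|m IH]; first by rewrite addn0 subrr normr0 add0r.
  rewrite addnS; have [_ _ h _ _] := Pb (n + m)%N.
  apply: le_trans IH; rewrite -(subrKA (b (n + m)%N).1).
  rewrite (le_trans (lerD (ler_normD _ _) (lexx _)))//.
  by rewrite addrAC [leRHS]addrC lerD2r.
have bd n m : `|(b (n + m)%N).1 - (b n).1| <= (b n).2.
  by apply: le_trans (bb n m); rewrite lerDl ltW//; case: (Vb (n + m)%N).
have : cvg ((fun n => (b n).1) @ \oo).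
  apply: cauchy_cvg; apply: cauchy_exP => e e0.
  have [n ne] := exists_inv_pow2_lt e0.
  exists (b n).1; exists n => // m /= nm; rewrite -ball_normE /= distrC.
  by rewrite -(subnKC nm) (le_lt_trans (bd _ _))// (le_lt_trans (rb _)).
move=> /cvg_ex[l bl].
have lb n : `|l - (b n).1| <= (b n).2.
  apply: (@cvg_dist_le _ X _ \oo (fun n => (b n).1)) => //; exists n => // m /= nm;
    rewrite -(subnKC nm); exact: bd.
have Vl : V l.
  apply: (@closed_cvg _ X \oo _ (fun n => (b n).1) V clV) => //; apply: nearW => n;
    exact: (proj1 (Vb n)).
have [n _ Cl] := VC _ Vl.
by have [_ _ _ _ /(_ _ (lb n.+1))] := Pb n.
Qed.

End baire.

Lemma cvg_sum_seq (K : numFieldType) (V : normedModType K) (T I : Type)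
    (W : set_system T) (A : seq I) (u : I -> T -> V) (l : I -> V) :
  Filter W -> (forall i, u i @ W --> l i) ->
  (fun t => \sum_(i <- A) u i t) @ W --> \sum_(i <- A) l i.
Proof.
move=> FW ul; elim: A => [|i A IH].
  by rewrite big_nil; under eq_fun do rewrite big_nil; exact: cvg_cst.
by rewrite big_cons; under eq_fun do rewrite big_cons; exact: cvgD.
Qed.

(* [FF] will be the set of initial segments for a basic sequence, and the set
   of all duplicate-free sequences for an unconditional basis. *)
Section basis_constant.
Context (R : realType) (k : scalar_kind).
Local Notation K := (scalar_field R k).
Context (X : completeNormedModType K) (V : set X) (x : nat -> X)
  (c : X -> nat -> K) (FF : set (seq nat)).
Hypothesis closedV : closed V.
Hypothesis V0 : V 0.
Hypothesis linV : forall a u v, V u -> V v -> V (a *: u + v).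
Hypothesis expand : forall v, V v -> series (fun i => c v i *: x i) @ \oo --> v.
Hypothesis expand_uniq : forall v a, V v ->
  series (fun i => a i *: x i) @ \oo --> v -> a = c v.
Hypothesis FF_initial : forall n, FF (index_iota 0 n).
Local Notation psum v A := (\sum_(i <- A) c v i *: x i).
Hypothesis FF_bounded : forall v, V v ->
  exists M : K, forall A, FF A -> `|psum v A| <= M.

Lemma expansion_coord_linear a u v i : V u -> V v -> c (a *: u + v) i = a * c u i + c v i.
Proof.
move=> Vu Vv.
rewrite -(@expand_uniq (a *: u + v) (fun i => a * c u i + c v i)) => [//|//|];
  first exact: linV.
rewrite (_ : series _ = a \*: series (fun i => c u i *: x i) +
    series (fun i => c v i *: x i)); last first.
  apply/funext => n; rewrite !fctE /series /= scaler_sumr -big_split /=.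
  by apply: eq_bigr => j _; rewrite scalerDl scalerA.
by apply: cvgD; [apply: cvgZl_tmp; exact: expand|exact: expand].
Qed.

Lemma partial_sum_linear a u v A : V u -> V v ->
  psum (a *: u + v) A = a *: psum u A + psum v A.
Proof.
move=> Vu Vv; rewrite scaler_sumr -big_split /=; apply: eq_bigr => i _.
by rewrite expansion_coord_linear// scalerDl scalerA.
Qed.

Lemma expansion_coord0 i : c 0 i = 0.
Proof.
by rewrite -(@expand_uniq 0 (fun=> 0))//; under eq_fun do rewrite scale0r;
  rewrite (_ : series _ = 0); [exact: cvg_cst|apply/funext=> n; exact: big1].
Qed.

Lemma partial_sum0 A : psum 0 A = 0.
Proof. by rewrite big1// => i _; rewrite expansion_coord0 scale0r. Qed.

Lemma partial_sumB u v A : V u -> V v -> psum (u - v) A = psum u A - psum v A.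
Proof. by move=> Vu Vv; rewrite addrC -scaleN1r partial_sum_linear// scaleN1r addrC. Qed.

Lemma subV u v : V u -> V v -> V (u - v).
Proof. by move=> Vu Vv; rewrite addrC -scaleN1r; exact: linV. Qed.

(** Otherwise 0 would have a second expansion, with [i]-th coefficient 1. *)
Lemma basis_neq0 i : x i != 0.
Proof.
apply/eqP => xi0.
have : (fun j => (j == i)%:R) = c 0.
  apply: expand_uniq => //; rewrite (_ : series _ = 0); first exact: cvg_cst.
  apply/funext => n; apply: big1 => j _.
  by have [->|] := eqVneq j i; rewrite ?xi0 ?scaler0 ?scale0r.
by move=> /(congr1 (@^~ i))/eqP; rewrite eqxx expansion_coord0 oner_eq0.
Qed.

(** The density half of the open mapping argument. By Baire, the vectors of [V] whose sums over [FF]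
    are all bounded by some [N] are dense in a ball of [V]; rescaled differences of such vectors
    approximate every [w]. *)
Lemma basis_dense_step : exists2 M : K, 0 < M & forall w t d, V w -> `|w| < t ->
  0 < d -> exists u, [/\ V u, `|w - u| < d & forall A, FF A -> `|psum u A| <= M * t].
Proof.
pose C n := [set v | V v /\ forall A, FF A -> `|psum v A| <= n%:R].
have [|N [v [r [Vv r0 vr]]]] := @baire_closed_cover _ _ X V C _ closedV V0.
  move=> v Vv; have [M MA] := FF_bounded Vv.
  have M0 : 0 <= M by exact: le_trans (MA _ (FF_initial 0)).
  have [n Mn] := scalar_archi M0; exists n => //; split=> // A FA.
  exact: le_trans (MA _ FA) (ltW Mn).
(* The difference of two vectors of [C N] has sums bounded by [2 N], and [r] is the radius to
   rescale by; adding 1 keeps the constant positive. *)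
exists ((2 * N%:R + 1) / r).
  by rewrite divr_gt0// ltr_wpDl// mulr_ge0.
move=> w t d Vw wt d0; have t0 : 0 < t by exact: le_lt_trans wt.
have approx w' : V w' -> `|w' - v| < r ->
    exists2 u, C N u & `|w' - u| < d * (r / t) / 2.
  move=> Vw' w'v; have e0 : 0 < d * (r / t) / 2 by rewrite !mulr_gt0// invr_gt0.
  have [u [Cu]] := vr _ Vw' w'v _ (nbhsx_ballx w' _ e0).
  by rewrite -ball_normE /=; exists u.
have Vw1 : V ((r / t) *: w + v) by exact: linV.
have [|u1 [Vu1 Cu1] wu1] := approx _ Vw1.
  rewrite addrK normrZ gtr0_norm ?divr_gt0// mulrAC ltr_pdivrMr// ltr_pM2l//.
have [|u2 [Vu2 Cu2] vu2] := approx _ Vv; first by rewrite subrr normr0.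
exists ((t / r) *: (u1 - u2)); split.
- by rewrite -[X in V X]addr0; apply: linV => //; exact: subV.
- have -> : w - (t / r) *: (u1 - u2) =
      (t / r) *: (((r / t) *: w + v - u1) - (v - u2)).
    rewrite !opprB [u2 - v]addrC addrACA addrK [- u1 + _]addrC [RHS]scalerDr.
    rewrite scalerA mulrA divfK ?gt_eqF// divff ?gt_eqF// scale1r; congr (_ + _).
    by rewrite -scalerN opprB.
  rewrite normrZ gtr0_norm ?divr_gt0// -ltr_pdivlMl ?divr_gt0// invf_div.
  rewrite (le_lt_trans (ler_normB _ _))// [ltRHS]splitr [r / t * d]mulrC ltrD//.
- move=> A FA; rewrite -[X in psum X A]addr0 partial_sum_linear ?partial_sum0 ?addr0//;
  last exact: subV.
  rewrite normrZ gtr0_norm ?divr_gt0// partial_sumB//.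
  rewrite [leRHS]mulrAC -mulrA [leRHS]mulrC ler_pM2l ?divr_gt0//.
  rewrite (le_trans (ler_normB _ _))// ler_wpDr// mulr_natl mulr2n lerD//.
    exact: Cu1.
  exact: Cu2.
Qed.

(** Iterating [basis_dense_step] on the remainders writes [w] as a series of vectors with
    geometrically decreasing sums; adding up the bounds gives the factor 4. *)
Lemma basis_constant : exists2 M : K, 0 <= M &
  forall v A, V v -> FF A -> `|psum v A| <= M * `|v|.
Proof.
have [M M0 stepM] := basis_dense_step.
exists (4 * M) => [|w A Vw FA]; first by rewrite mulr_ge0// ltW.
have [->|w0] := eqVneq w 0; first by rewrite partial_sum0 !normr0 mulr0.
have {w0}w0 : 0 < `|w| by rewrite normr_gt0.
(* The factor 2 makes [t 0] strictly larger than the norm of [w], as the first step requires. *)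
pose t n := 2 * `|w| / 2 ^+ n : K.
have t0 n : 0 < t n by rewrite divr_gt0 ?mulr_gt0 ?exprn_gt0.
have tS n : t n = t n.+1 + t n.+1.
  by rewrite /t exprS invfM [_^-1 * _]mulrC mulrA -splitr.
have step (nw : nat * X) : exists u, V nw.2 -> `|nw.2| < t nw.1 ->
    [/\ V u, `|nw.2 - u| < t nw.1.+1
      & forall A, FF A -> `|psum u A| <= M * t nw.1].
  case: nw => n v /=; have [[Vv vt]|h] := pselect (V v /\ `|v| < t n).
    by have [u uP] := stepM _ _ _ Vv vt (t0 n.+1); exists u.
  by exists 0 => Vv vt; case: h.
have [f fP] := choice step.
pose fix r n := if n is m.+1 then r m - f (m, r m) else w.
have rP n : V (r n) /\ `|r n| < t n.
  elim: n => [|n [Vr rt]] /=.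
    by rewrite /t expr0 divr1 ltr_pMl ?ltr1n.
  by have [Vf ? _] := fP (n, r n) Vr rt; split=> //; exact: subV.
have fV n : V (f (n, r n)) by have [? /(fP (n, r n) _)[]] := rP n.
pose s n := w - r n.
have sV n : V (s n) by apply: subV => //; case: (rP n).
have sS n : s n.+1 = s n + f (n, r n) by rewrite /s /= opprB addrCA addrC.
(* Since [t j = 2 (t j - t (j + 1))], the bounds [M * t j] of the added vectors telescope. *)
have sbound B n m : FF B ->
    `|psum (s (n + m)%N) B - psum (s n) B| <= 2 * M * (t n - t (n + m)%N).
  move=> FB; elim: m => [|m IH]; first by rewrite addn0 !subrr normr0 mulr0.
  have -> : 2 * M * (t n - t (n + m.+1)%N) =
      2 * M * (t n - t (n + m)%N) + M * t (n + m)%N.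
    by rewrite addnS (tS (n + m)%N); ring.
  rewrite addnS sS -[s _]scale1r partial_sum_linear// scale1r addrAC.
  rewrite (le_trans (ler_normD _ _))// lerD//.
  have [Vr rt] := rP (n + m)%N; by have [_ _ ->] := fP (_, r _) Vr rt.
have {}sbound B n : FF B ->
    \forall m \near \oo, `|psum (s m) B - psum (s n) B| <= 2 * M * t n.
  move=> FB; exists n => // m /= nm; rewrite -(subnKC nm).
  rewrite (le_trans (sbound _ _ _ FB))// ler_pM2l ?mulr_gt0// gerBl ltW//.
(* The vectors [s n] converge to [w]; limits of their coordinates along an
   ultrafilter give a priori only some expansion, which uniqueness then
   identifies with that of [w]. *)
have [W [UW ooW]] := @ultraFilterLemma nat \oo _.
have /choice[a sa] i : exists l : K, (fun m => c (s m) i) @ W --> l.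
  have xi0 : 0 < `|x i| by rewrite normr_gt0 basis_neq0.
  (* A single term is the difference of two initial sums, each of which stays within [2 M t 0] of
     its value for [s 0]. *)
  apply: (@scalar_ultra_cvg R k nat W _
    ((2 * M * t 0 + 2 * M * t 0 + `|c (s 0) i *: x i|) / `|x i|)).
  apply: ooW; near=> m; rewrite ler_pdivlMr// -normrZ.
  rewrite -(subrK (c (s 0) i *: x i) (c (s m) i *: x i)).
  rewrite (le_trans (ler_normD _ _))// lerD2r.
  have diff v : c v i *: x i = psum v (index_iota 0 i.+1) - psum v (index_iota 0 i).
    by rewrite big_nat_recr//= addrAC subrr add0r.
  have subACA (p q p0 q0 : X) : (p - q) - (p0 - q0) = (p - p0) - (q - q0).
    by rewrite !opprB [q0 - p0]addrC addrACA [- q + _]addrC.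
  rewrite !diff subACA (le_trans (ler_normB _ _))// lerD//; near: m.
    exact: sbound.
  exact: sbound.
have limA B n : FF B -> `|\sum_(i <- B) a i *: x i - psum (s n) B| <= 2 * M * t n.
  move=> FB; apply: (@cvg_dist_le _ X _ W (fun m => psum (s m) B)).
    by apply: cvg_sum_seq => i; apply: cvgZr_tmp; exact: sa.
  by apply: ooW; exact: sbound.
suff aw : a = c w.
  have := limA _ 0 FA; rewrite aw /s /= subrr partial_sum0 subr0.
  by rewrite /t expr0 divr1 mulrA (_ : 2 * M * 2 = 4 * M)//; ring.
apply: expand_uniq => //; apply/cvgrPdist_le => /= e e0.
(* With this [N], half of [e] pays for the remainder [r N] and for exchanging the coefficients [a]
   with those of [s N]; the expansion of [s N] takes the other half. *)
have [N] : exists N, 2 ^- N < e / 2 / (2 * `|w| * (1 + 2 * M)) :> K.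
  apply: exists_inv_pow2_lt; rewrite divr_gt0// ?divr_gt0// mulr_gt0 ?mulr_gt0//.
  by rewrite addr_gt0// mulr_gt0.
rewrite ltr_pdivlMr; last by rewrite mulr_gt0 ?mulr_gt0// addr_gt0 ?mulr_gt0.
rewrite mulrA [2 ^- N * _]mulrC -/(t N) => /ltW tN.
have /cvgrPdist_le/(_ _ (divr_gt0 e0 (ltr0Sn _ 1))) := expand (sV N).
apply: filterS => n sn.
have -> : w - series (fun i => a i *: x i) n =
    (s N - series (fun i => c (s N) i *: x i) n) +
    (r N - (series (fun i => a i *: x i) n - series (fun i => c (s N) i *: x i) n)).
  by rewrite opprB addrCA subrKA addrA [r N + _]addrC /s subrK.
rewrite [e]splitr (le_trans (ler_normD _ _))// lerD//.
apply: le_trans tN; rewrite (le_trans (ler_normB _ _))// mulrDr mulr1 lerD//.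
  by apply/ltW; case: (rP N).
by rewrite mulrC; apply: limA; exact: FF_initial.
Unshelve. all: by end_near. Qed.


End basis_constant.

(** * Unconditional convergence *)

Lemma real_not_lt (K : numDomainType) (x y : K) :
  x \is Num.real -> y \is Num.real -> ~ x < y -> y <= x.
Proof. by move=> xr yr; rewrite (real_leNgt yr xr) => /negP. Qed.

Section unconditional.
Context (R : realType) (k : scalar_kind).
Local Notation K := (scalar_field R k).
Context (X : normedModType K).

(* In each block [N n, N n.+1) the permutation lists the elements of [A n]
   first. *)
Lemma block_permutation (N : nat -> nat) (A : nat -> seq nat) :
  N 0%N = 0%N -> (forall n, (N n < N n.+1)%N) ->
  (forall n, uniq (A n) /\ {subset A n <= index_iota (N n) (N n.+1)}) ->
  exists s : nat -> nat, bijective s /\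
    forall n j, (j < size (A n))%N -> s (N n + j)%N = nth 0%N (A n) j.
Proof.
move=> N0 Nlt AP.
pose L n := A n ++ [seq i <- index_iota (N n) (N n.+1) | i \notin A n].
have NS n : (n <= N n)%N by elim: n => [//|n IH]; exact: leq_ltn_trans (Nlt n).
have Nmono : {homo N : m n / (m <= n)%N}.
  by apply: homo_leq => // [m n p|n]; [exact: leq_trans|exact: ltnW].
have LP n : perm_eq (L n) (index_iota (N n) (N n.+1)).
  apply: uniq_perm; rewrite ?iota_uniq//.
    rewrite cat_uniq (proj1 (AP n)) filter_uniq ?iota_uniq// andbT.
    by apply/hasPn => i; rewrite mem_filter => /andP[].
  move=> i; rewrite mem_cat mem_filter.
  by have [/(proj2 (AP n))->|] := boolP (i \in A n).
have Luniq n : uniq (L n) by rewrite (perm_uniq (LP n)) iota_uniq.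
have Lsize n : size (L n) = (N n.+1 - N n)%N.
  by rewrite (perm_size (LP n)) size_iota.
have Lmem n i : (i \in L n) = (N n <= i < N n.+1)%N.
  by rewrite (perm_mem (LP n)) mem_index_iota.
have ex n : exists m, (n < N m.+1)%N by exists n; exact: leq_trans (NS _).
(* The block containing [n] is the first one that ends beyond [n]. *)
pose b n := ex_minn (ex n).
have bP n : (N (b n) <= n < N (b n).+1)%N.
  rewrite /b; case: ex_minnP => m -> mmin; rewrite andbT.
  case: m mmin => [|m] mmin; first by rewrite N0.
  by rewrite leqNgt; apply/negP => /mmin; rewrite ltnn.
have bE n m : (N m <= n < N m.+1)%N -> b n = m.
  move=> /andP[mn nm]; have /andP[bn nb] := bP n.
  apply/eqP; rewrite eqn_leq; apply/andP; split.
    by rewrite leqNgt; apply/negP => /Nmono h; move: (leq_trans nm (leq_trans h bn));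
      rewrite ltnn.
  by rewrite leqNgt; apply/negP => /Nmono h; move: (leq_trans nb (leq_trans h mn));
    rewrite ltnn.
pose s n := nth 0%N (L (b n)) (n - N (b n)).
pose t m := (N (b m) + index m (L (b m)))%N.
have blt n : (n - N (b n) < size (L (b n)))%N.
  by have /andP[h1 h2] := bP n; rewrite Lsize ltn_sub2r// (leq_ltn_trans h1).
have bs n : b (s n) = b n by apply: bE; rewrite -Lmem mem_nth.
have bt n : b (t n) = b n.
  apply: bE; rewrite /t leq_addr/= -ltn_subRL -Lsize index_mem Lmem; exact: bP.
exists s; split.
  exists t => n.
    rewrite /t bs /s index_uniq ?blt//; have /andP[h _] := bP n.
    by rewrite subnKC.
  by rewrite /s bt /t addKn nth_index// Lmem; exact: bP.
move=> n j jA; rewrite /s; have -> : b (N n + j)%N = n; last first.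
  by rewrite addKn nth_cat jA.
apply: bE; rewrite leq_addr/= -ltn_subRL -Lsize.
by rewrite size_cat ltn_addr.
Qed.

(** Otherwise finite sets arbitrarily far out have sums of norm at least [e]. A permutation listing
    such sets contiguously in successive blocks gives a series that is not Cauchy. *)
Lemma unconditional_small_tails (u : nat -> X) : unconditionally_convergent u ->
  forall e : K, 0 < e -> exists N : nat, forall A : seq nat, uniq A ->
    (forall i, i \in A -> (N <= i)%N) -> `|\sum_(i <- A) u i| < e.
Proof.
move=> uu e e0; apply: contrapT => nN.
have /choice[f fP] (N : nat) : exists A : seq nat, [/\ uniq A,
    forall i, i \in A -> (N <= i)%N & e <= `|\sum_(i <- A) u i| ].
  apply: contrapT => nA; apply: nN; exists N => A uA AN.
  apply: contrapT => Ae; apply: nA; exists A; split=> //.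
  by apply: real_not_lt => //; rewrite gtr0_real.
(* Each block ends beyond all indices of the finite set chosen at its start. *)
pose fix N n := if n is m.+1 then (maxn (N m) (\max_(i <- f (N m)) i)).+1 else 0%N.
have [||s [sbij sN]] := @block_permutation N (f \o N) erefl.
- by move=> n; rewrite ltnS leq_maxl.
- move=> n; have [uA AN _] := fP (N n); split=> // i iA.
  rewrite mem_index_iota AN//= ltnS leq_max; apply/orP; right.
  exact: leq_bigmax_seq.
have /cvg_ex[l /cvgrPdist_lt/(_ _ (divr_gt0 e0 (ltr0Sn _ 1)))] := uu s sbij.
move=> [n0 _ n0P].
have Nn0 : (n0 <= N n0)%N.
  by elim: (n0) => // n IH; rewrite ltnS (leq_trans IH)// leq_maxl.
have [_ _] := fP (N n0); apply/negP; rewrite -real_ltNge ?normr_real ?(gtr0_real e0)//.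
pose m := (N n0 + size (f (N n0)))%N.
have -> : \sum_(i <- f (N n0)) u i = series (u \o s) m - series (u \o s) (N n0).
  rewrite /series /= (@big_cat_nat _ _ _ (N n0) 0 m)//= ?leq_addr// addrAC subrr add0r.
  rewrite (big_nth 0%N) -[X in index_iota X m]add0n big_addn addKn.
  by apply: eq_big_nat => j /andP[_ jA]; rewrite addnC sN.
rewrite -(subrKA l) [e]splitr (le_lt_trans (ler_normD _ _))// ltrD//.
  by rewrite distrC n0P//= (leq_trans Nn0)// leq_addr.
by rewrite n0P.
Qed.

End unconditional.

(** * Finitely additive set functions *)

Section charges.
Context (R : realType) (nu : set nat -> R) (M : R).
Hypothesis nuU : forall A B, A `&` B = set0 -> nu (A `|` B) = nu A + nu B.
Hypothesis nu_bounded : forall A, nu A <= M.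
Hypothesis nu1 : forall n, nu [set n] = 0.

Lemma charge_set0 : nu set0 = 0.
Proof.
by apply: (addrI (nu set0)); rewrite -nuU ?setIid// setUid addr0.
Qed.

Lemma charge_finite A : finite_set A -> nu A = 0.
Proof.
move=> /finite_seqP[s ->]; elim: s => [|n s IH].
  by rewrite (_ : [set` _] = set0) ?charge_set0//; apply/seteqP; split.
have [ns|ns] := boolP (n \in s).
  suff -> : [set` n :: s] = [set` s] by [].
  by apply/seteqP; split=> m /=; rewrite inE; [case/predU1P => [->|]|move=> ->;
    rewrite orbT].
have -> : [set` n :: s] = [set n] `|` [set` s].
  by apply/seteqP; split=> m /=; rewrite inE;
    [case/predU1P => [->|]; [left|right]|case=> [->|->]; rewrite ?eqxx ?orbT].
rewrite nuU ?IH ?nu1 ?addr0//.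
by apply/seteqP; split => // m [/= -> ms]; rewrite ms in ns.
Qed.

(** The overlap is finite, hence null, and can be removed from [A]. *)
Lemma charge_setU_ad A B : finite_set (A `&` B) -> nu (A `|` B) = nu A + nu B.
Proof.
move=> fAB; have -> : A `|` B = (A `\` B) `|` B
  by rewrite setDE setUIl setUC [~` B `|` _]setUC setUCr setIT setUC.
have {2}-> : A = (A `&` B) `|` (A `\` B)
  by rewrite setUC setDE -setIUr setUC setUCr setIT.
rewrite !nuU ?(charge_finite fAB) ?add0r//.
- by apply/seteqP; split=> // n [[_ Bn] [_ nBn]]; exact: nBn.
- by apply/seteqP; split=> // n [[_ nBn] Bn]; exact: nBn.
Qed.

(** On almost disjoint sets the charge still adds up, so the union of the chosen members has charge
    at least [size s] times [d]. *)
Lemma almost_disjoint_charge_le (T : eqType) (F : T -> set nat) (d : R) (s : seq T) :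
  (forall a b, a != b -> finite_set (F a `&` F b)) ->
  (forall a, a \in s -> d < nu (F a)) -> uniq s -> (size s)%:R * d <= M.
Proof.
move=> adF; suff H : (forall a, a \in s -> d < nu (F a)) -> uniq s ->
    (size s)%:R * d <= nu (\bigcup_(a in [set` s]) F a).
  by move=> ds us; exact: le_trans (H ds us) (nu_bounded _).
elim: s => [|a s IH] /= ds us.
  by rewrite (_ : [set` _] = set0) ?bigcup_set0 ?charge_set0 ?mul0r//; apply/seteqP;
    split.
have /andP[as_ {}us] := us.
have -> : \bigcup_(b in [set` a :: s]) F b = F a `|` \bigcup_(b in [set` s]) F b.
  apply/seteqP; split=> n.
    by move=> [b /=]; rewrite inE => /predU1P[->|bs] Fb; [left|right; exists b].
  move=> [Fa|[b /= bs Fb]]; first by exists a => //=; rewrite inE eqxx.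
  by exists b => //=; rewrite inE bs orbT.
rewrite charge_setU_ad; last first.
  rewrite setI_bigcupr; apply: bigcup_finite; first exact: finite_seq.
  by move=> b /= bs; apply: adF; apply: contraNneq as_ => ->.
rewrite -natr1 mulrDl mul1r addrC lerD//; first by rewrite ltW// ds// inE eqxx.
by apply: IH => // b bs; apply: ds; rewrite inE bs orbT.
Qed.

(** An infinite family would contain more than [M / d] members, too many for
    [almost_disjoint_charge_le]. *)
Lemma charge_gt_finite (T : choiceType) (F : T -> set nat) (d : R) : 0 < d ->
  (forall a b, a != b -> finite_set (F a `&` F b)) ->
  finite_set [set a | d < nu (F a)].
Proof.
move=> d0 adF; apply: contrapT => inf.
have [B BF Bn] := infinite_set_fset (Num.truncn (M / d)).+1 inf.
have := @almost_disjoint_charge_le T F d (finmap.enum_fset B) adF.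
have BP a : a \in finmap.enum_fset B -> d < nu (F a) by move=> aB; exact: BF.
move=> /(_ BP (finmap.fset_uniq B)); rewrite -ler_pdivlMr// => h.
have := le_lt_trans h (truncnS_gt _); rewrite ltr_nat => h2.
by have := leq_trans h2 Bn; rewrite ltnn.
Qed.

End charges.

(* The initial segments of [b], coded as integers: different branches of the
   binary tree have only finitely many nodes in common. *)
Definition branch (b : nat -> bool) : set nat :=
  range (fun n => pickle (mkseq b n)).

Lemma branch_almost_disjoint b c : b != c -> finite_set (branch b `&` branch c).
Proof.
move=> bc; have [n0 bcn] : exists n, b n != c n.
  apply: contrapT => h; move/eqP: bc; apply; apply/funext => n.
  by apply/eqP; apply: contrapT => /negP h'; apply: h; exists n.
apply: (@sub_finite_set _ _ [set pickle (mkseq b n) | n in `I_n0.+1]); last first.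
  by apply: finite_image; exact: finite_II.
move=> _ [[n _ <-] [m _ /(pcan_inj pickleK) cb]]; exists n => //=.
have nm : n = m by have := congr1 size cb; rewrite !size_mkseq.
rewrite ltnS leqNgt; apply/negP => n0n; move: bcn; rewrite -nm in cb.
by rewrite -(nth_mkseq true b n0n) -(nth_mkseq true c n0n) cb eqxx.
Qed.

(** Cantor's diagonal argument: [d] negates at [n] the sequence that [f] sends to [n]. *)
Lemma uncountable_branches : ~ countable [set: nat -> bool].
Proof.
move=> /countable_injP[f finj].
pose d n := ~~ `[< exists2 b, f b = n & b n >].
have [dd|dd] := boolP (d (f d)).
  by move: (dd); rewrite {1}/d => /asboolPn; apply; exists d.
move: (dd); rewrite {1}/d negbK => /asboolP[b fbd bd].
have bd' : b = d by apply: finj => //; rewrite inE.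
by move: dd; rewrite -bd' fbd bd' -{1}bd' bd.
Qed.

(** For each [j] and [q] only finitely many branches have charge above [1/(q+1)] in absolute value.
    These exceptions are countable in all while the branches are not, and [s] enumerates a branch
    that avoids them. *)
Lemma charges_null_infinite_set (R : realType) (J : countType)
    (mu : J -> set nat -> R) :
  (forall j A B, A `&` B = set0 -> mu j (A `|` B) = mu j A + mu j B) ->
  (forall j, exists M, forall A, `|mu j A| <= M) ->
  (forall j n, mu j [set n] = 0) ->
  exists2 s : nat -> nat, injective s & forall j, mu j (range s) = 0.
Proof.
move=> muU mu_bounded mu1.
pose bad (jq : J * nat) := [set b | jq.2.+1%:R^-1 < mu jq.1 (branch b)] `|`
  [set b | jq.2.+1%:R^-1 < - mu jq.1 (branch b)].
have badfin jq : finite_set (bad jq).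
  have [M muM] := mu_bounded jq.1.
  have q0 : (0 : R) < jq.2.+1%:R^-1 by rewrite invr_gt0.
  rewrite /bad finite_setU; split.
    apply: (@charge_gt_finite R (mu jq.1) M) => //; first exact: muU.
      by move=> A; exact: le_trans (ler_norm _) (muM A).
    exact: branch_almost_disjoint.
  apply: (@charge_gt_finite R (fun A => - mu jq.1 A) M) => //.
  - by move=> A B AB; rewrite muU// opprD.
  - by move=> A; rewrite (le_trans (ler_norm _))// normrN.
  - by move=> n; rewrite mu1 oppr0.
  - exact: branch_almost_disjoint.
have [b bgood] : exists b, forall jq, ~ bad jq b.
  apply: contrapT => h; apply: uncountable_branches.
  apply: (@sub_countable _ _ _ (\bigcup_jq bad jq)).
    apply: subset_card_le => b _; apply: contrapT => nb; apply: h; exists b => jq bj.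
    by apply: nb; exists jq.
  apply: bigcup_countable => [|jq _]; first exact: countableP.
  exact: finite_set_countable.
exists (fun n => pickle (mkseq b n)).
  by move=> n m /(pcan_inj pickleK) /(congr1 size); rewrite !size_mkseq.
move=> j; apply/eqP; rewrite -normr_le0 leNgt; apply/negP => mu0.
set z := `|_| in mu0.
pose q := Num.truncn z^-1.
have qz : q.+1%:R^-1 < z.
  by rewrite -[ltRHS]invrK ltf_pV2 ?posrE ?invr_gt0// truncnS_gt.
apply: (bgood (j, q)); move: qz; rewrite /z /bad /= -/(branch b).
by have [m0|m0] := lerP 0 (mu j (branch b));
  rewrite ?(ger0_norm m0) ?(ltr0_norm m0) => qz; [left|right].
Qed.

(** * Coordinates and multipliers of bases *)

Lemma cvg_series_delta (K : numFieldType) (X : normedModType K) (x : nat -> X) i (a : K) :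
  series (fun j => (if j == i then a else 0) *: x j) @ \oo --> a *: x i.
Proof.
apply: cvg_near_cst; exists i.+1 => // n /= ni.
rewrite /series /= big_mkord (bigD1 (Ordinal ni)) //= eqxx big1 ?addr0// => j.
by rewrite -val_eqE /= => /negPf ->; rewrite scale0r.
Qed.

Lemma cvg_norm_bounded (R : realType) (k : scalar_kind)
    (X : normedModType (scalar_field R k)) (u : nat -> X) (l : X) :
  u @ \oo --> l -> exists M : scalar_field R k, forall n, `|u n| <= M.
Proof.
move=> /cvgrPdist_lt/(_ _ ltr01)[N _ Nu].
exists (`|l| + 1 + \sum_(i < N) `|u i|) => n.
have [nN|Nn] := ltnP n N.
  rewrite (bigD1 (Ordinal nN))//= addrCA lerDl.
  by rewrite addr_ge0// ?addr_ge0// sumr_ge0.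
rewrite ler_wpDr ?sumr_ge0// -[u n](subrK l) addrC (le_trans (ler_normD _ _))//.
by rewrite lerD2l distrC ltW// Nu.
Qed.

Section schauder.
Context (R : realType) (k : scalar_kind).
Local Notation K := (scalar_field R k).
Context (X : completeNormedModType K) (x : nat -> X).

Lemma schauder_coordinates (V : set X) : schauder_basis_of V x ->
  exists c : X -> nat -> K, forall v, V v ->
    series (fun i => c v i *: x i) @ \oo --> v /\
    forall a, series (fun i => a i *: x i) @ \oo --> v -> a = c v.
Proof.
move=> [_ Vx].
have /choice[c cP] (v : X) : exists c : nat -> K, V v ->
    series (fun i => c i *: x i) @ \oo --> v /\
    forall a, series (fun i => a i *: x i) @ \oo --> v -> a = c.
  have [Vv|] := pselect (V v); last by exists (fun=> 0).
  have [a [av au]] := Vx _ Vv; exists a => _; split=> // b /au.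
  by move=> ->.
by exists c.
Qed.

Lemma basic_span_expansion v : basic_sequence x ->
  closure (linear_span x) v <-> exists a, series (fun i => a i *: x i) @ \oo --> v.
Proof.
move=> [_ bx]; split=> [/bx[a [av _]]|[a av]]; first by exists a.
apply: (@closed_cvg _ X \oo _ (series (fun i => a i *: x i))
  (closure (linear_span x))) => //.
  exact: closed_closure.
apply: nearW => n; apply: subset_closure; exists n, a.
by rewrite /series /= big_mkord.
Qed.

(** The coordinates are bounded on the closed span, and Hahn-Banach extends their real parts. As
    [f j] is only real-linear, its values are given at all scalar multiples of [x i]. *)
Lemma basic_sequence_functionals : basic_sequence x -> seminormalized x ->
  exists (M : R) (f : nat -> X -> R), forall j,
    [/\ forall u v, f j (u + v) = f j u + f j v,
        forall u, `|f j u| <= M * scalar_re `|u|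
      & forall i a, f j (a *: x i) = if i == j then scalar_re a else 0].
Proof.
move=> bx [a [a1 [a0 xa]]]; have VE v := basic_span_expansion v bx.
pose V := closure (linear_span x); have [xV _] := bx.
have [c cP] := schauder_coordinates bx.
have V0 : V 0.
  apply/VE; exists (fun=> 0); under eq_fun do rewrite scale0r.
  by rewrite (_ : series _ = 0); [exact: cvg_cst|apply/funext => n; exact: big1].
have linV (b : K) u v : V u -> V v -> V (b *: u + v).
  move=> /VE[s su] /VE[t tv]; apply/VE; exists (fun i => b * s i + t i).
  rewrite (_ : series _ = b \*: series (fun i => s i *: x i) +
      series (fun i => t i *: x i)); last first.
    apply/funext => n; rewrite !fctE /series /= scaler_sumr -big_split /=.
    by apply: eq_bigr => j _; rewrite scalerDl scalerA.
  by apply: cvgD => //; exact: cvgZl_tmp.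
have cexp v (Vv : V v) := proj1 (cP v Vv).
have cuniq v a' (Vv : V v) := proj2 (cP v Vv) a'.
have [||M M0 cM] := @basis_constant _ _ X V x c (range (index_iota 0))
  (@closed_closure _ _) V0 linV cexp cuniq.
- by move=> n; exists n.
- move=> v /cexp/cvg_norm_bounded[M uM]; exists M => _ [n _ <-]; exact: uM.
(* One term is the difference of two initial sums, each bounded by [M] times the norm of [v];
   dividing by the lower bound [a] of the basis vectors bounds the coordinate. *)
pose M' := 2 * M / a.
have cM' v j : V v -> `|c v j| <= M' * `|v|.
  move=> Vv; rewrite /M' mulrAC ler_pdivlMr//.
  rewrite (@le_trans _ _ (`|c v j| * `|x j|))//.
    by rewrite ler_wpM2l// ltW//; case/andP: (xa j).
  rewrite -normrZ; have -> : c v j *: x j = \sum_(i <- index_iota 0 j.+1) c v i *: x i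
      - \sum_(i <- index_iota 0 j) c v i *: x i.
    by rewrite big_nat_recr//= addrAC subrr add0r.
  rewrite (le_trans (ler_normB _ _))// -mulrA mulr_natl mulr2n lerD//; exact: cM.
pose p (v : X) := scalar_re (M' * `|v|).
have M'0 : 0 <= M' by rewrite divr_ge0 ?mulr_ge0 ?(ltW a0).
have pE v : p v = scalar_re M' * scalar_re `|v|.
  by rewrite /p -{1}(@scalar_injK _ _ M') ?ger0_real// scalar_re_injM.
exists (scalar_re M').
suff H j : exists f : X -> R,
    [/\ forall u v, f (u + v) = f u + f v,
        forall u, `|f u| <= scalar_re M' * scalar_re `|u|
      & forall i a, f (a *: x i) = if i == j then scalar_re a else 0].
  by have [f fP] := choice H; exists f.
have [|||f [fD fZ fp fG]] :=
  @hahn_banach R k X p _ _ [set (v, scalar_re (c v j)) | v in V].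
- move=> u v; rewrite /p -scalar_reD -mulrDr; apply: le_scalar_re.
  by rewrite ler_wpM2l// ler_normD.
- move=> b u b0; rewrite !pE normrZ ger0_norm ?scalar_inj_ge0// scalar_re_injM; ring.
- split=> [|b _ _ [u Vu <-] [v Vv <-]|_ [v Vv <-]] /=.
  + exists 0 => //; rewrite (_ : c 0 j = 0) ?scalar_re0//.
    exact: (expansion_coord0 V0 cuniq).
  + exists (scalar_inj k b *: u + v); first exact: linV.
    by rewrite (expansion_coord_linear linV cexp cuniq)// scalar_reD scalar_re_injM.
  + rewrite (le_trans (ler_norm _))// (le_trans (norm_scalar_re_le _))//.
    by apply: le_scalar_re; exact: cM'.
exists f; split=> // [u|i b].
  rewrite -pE ler_norml fp andbT lerNl.
  have -> : p u = p (- u) by rewrite /p normrN.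
  have -> : - f u = f (- u); last exact: fp.
  have f0 : f 0 = 0 by have := fZ 0 0; rewrite scaler0 mul0r.
  by apply: (addrI (f u)); rewrite -fD !subrr f0.
have Vi : V (b *: x i) by have := linV b _ _ (xV i) V0; rewrite addr0.
have -> : f (b *: x i) = scalar_re (c (b *: x i) j).
  by apply: (fG (_, _)); exists (b *: x i).
rewrite -(cuniq _ _ Vi (@cvg_series_delta _ X x i b)) eq_sym.
by case: ifP => _ //; rewrite scalar_re0.
Qed.

End schauder.

Section multipliers.
Context (R : realType) (k : scalar_kind).
Local Notation K := (scalar_field R k).
Context (G : completeNormedModType K) (g : nat -> G) (g' : nat -> dual G).
Hypotheses (ug : unconditional_basis g) (gg' : coordinate_functionals g g').

Lemma basis_expansion v : series (fun i => g' i v *: g i) @ \oo --> v.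
Proof.
have [[_ bg] _] := ug; have [a [av _]] := bg v I.
by rewrite (_ : (fun i => _) = (fun i => a i *: g i))//; apply/funext => i;
  rewrite (gg' av).
Qed.

(** Partial sums of the projection of [v] onto the [g i] with [i] in [A]; zero terms off [A] keep
    the indexing of the full expansion. *)
Definition subseries (A : set nat) (v : G) :=
  series (fun i => (if `[< A i >] then g' i v else 0) *: g i).

Lemma subseries_diff A v m n : (m <= n)%N -> subseries A v n - subseries A v m =
  \sum_(i <- [seq i <- index_iota m n | `[< A i >]]) g' i v *: g i.
Proof.
move=> mn; rewrite /subseries /series /= (@big_cat_nat _ _ _ m 0 n)//= addrAC subrr add0r.
rewrite big_filter [RHS]big_mkcond; apply: eq_bigr => i _.
by case: ifP => // _; rewrite scale0r.
Qed.

Lemma basis_small_tails v (e : K) : 0 < e -> exists N : nat, forall A : seq nat, uniq A ->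
    (forall i, i \in A -> (N <= i)%N) -> `|\sum_(i <- A) g' i v *: g i| < e.
Proof.
move: e; apply: unconditional_small_tails; have [_ ucg] := ug; apply: ucg.
by apply/cvg_ex; exists v; exact: basis_expansion.
Qed.

(** Past some [N] every finite sum has norm below 1, and the indices before [N] contribute at most
    the sum of the norms of their terms. *)
Lemma finite_sums_bounded v : exists M : K, forall A, uniq A ->
  `|\sum_(i <- A) g' i v *: g i| <= M.
Proof.
have [N NP] := @basis_small_tails v 1 ltr01.
exists (\sum_(i <- index_iota 0 N) `|g' i v *: g i| + 1) => A uA.
rewrite (bigID (fun i => i < N)%N)/= (le_trans (ler_normD _ _))// lerD//.
  rewrite (le_trans (ler_norm_sum _ _ _))// -[leLHS]big_filter.
  rewrite (perm_big [seq i <- index_iota 0 N | i \in A]).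
    by rewrite big_filter big_mkcond; apply: ler_sum => i _; case: ifP.
  apply: uniq_perm; rewrite ?filter_uniq ?iota_uniq// => i.
  by rewrite !mem_filter mem_index_iota /= andbC.
rewrite -big_filter ltW// NP ?filter_uniq// => i.
by rewrite mem_filter -leqNgt => /andP[].
Qed.

Lemma subseries_cvg A v : cvgn (subseries A v).
Proof.
apply: cauchy_cvg; apply: cauchy_exP => e e0.
have [N NP] := basis_small_tails v e0.
exists (subseries A v N), N => // n /= Nn.
rewrite -ball_normE /= distrC subseries_diff// NP ?filter_uniq ?iota_uniq// => i.
by rewrite mem_filter mem_index_iota => /andP[_ /andP[]].
Qed.

(** [C] is independent of [A] because [basis_constant] is applied to all duplicate-free index
    sequences at once; the partial sums of every subseries are among the sums it bounds. *)
Lemma basis_multipliers : exists (C : K) (P : set nat -> bounded_op G G), forall A v,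
  `|P A v| <= C * `|v| /\ subseries A v @ \oo --> P A v.
Proof.
have [//|//|||||C C0 CP] :=
  @basis_constant _ _ G setT g (fun v i => g' i v) [set A | uniq A] closedT.
- by move=> v _; exact: basis_expansion.
- by move=> v a _ av; apply/funext => i; rewrite (gg' av).
- by move=> n; exact: iota_uniq.
- by move=> v _; exact: finite_sums_bounded.
pose Q A v := lim (subseries A v @ \oo).
have QE A v : subseries A v @ \oo --> Q A v by exact: subseries_cvg.
have QC A v : `|Q A v| <= C * `|v|.
  rewrite -[Q A v]subr0; apply: (@cvg_dist_le _ G _ \oo (subseries A v)) => //.
  apply: nearW => n; rewrite (_ : 0 = subseries A v 0%N).
    by rewrite subseries_diff// CP//= filter_uniq// iota_uniq.
  by rewrite /subseries /series /= big_geq.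
have Qop A : Q A \in @bounded_op_pred K G G.
  apply/asboolP; split; last by exists C.
  move=> a u v; apply: (cvg_unique _ (QE A (a *: u + v))); first exact: norm_hausdorff.
  rewrite (_ : subseries A _ = a \*: subseries A u + subseries A v); last first.
    apply/funext => n; rewrite !fctE /subseries /series /= scaler_sumr -big_split /=.
    apply: eq_bigr => i _; rewrite scalerA -scalerDl linearP.
    by case: ifP; rewrite ?mulr0 ?addr0.
  by apply: cvgD; [apply: cvgZl_tmp|]; exact: QE.
exists C, (fun A => BoundedOp (Qop A)) => A v; split; [exact: QC|exact: QE].
Qed.

End multipliers.

(** * Relative compactness and sequences of functionals *)

Lemma precompact_cvg_range (T : topologicalType) (u : nat -> T) (l : T) :
  hausdorff_space T -> u @ \oo --> l -> precompact (range u).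
Proof.
move=> hT ul; suff cl : compact (range u `|` [set l]).
  by exists (range u `|` [set l]); [move=> x; left|split=> //; exact: compact_closed].
move=> F PF FU; apply: contrapT => ncl.
have : ~ cluster F l by move=> lF; apply: ncl; exists l; split=> //; right.
move=> /existsNP[A /existsNP[B /not_implyP[FA /not_implyP[lB /set0P/negP/negPn/eqP AB]]]].
(* A filter that does not cluster at [l] contains a set of finitely many terms, and such a set is
   compact. *)
have [N _ NB] := ul _ lB.
have fD : finite_set (u @` `I_N) by apply: finite_image; exact: finite_II.
have FD : F (u @` `I_N).
  apply: filterS (filterI FA FU) => y [Ay [[n _ un]|yl]]; last first.
    have : (A `&` B) l by split; [rewrite -yl|exact: nbhs_singleton lB].
    by rewrite AB.
  exists n => //=; rewrite ltnNge; apply/negP => Nn.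
  have : (A `&` B) (u n) by split; [rewrite un|exact: NB].
  by rewrite AB.
have [x [[n _ <-] nF]] := finite_compact fD PF FD.
by apply: ncl; exists (u n); split=> //; left; exists n.
Qed.

Lemma bounded_op_continuous (K : numFieldType) (E F : normedModType K)
    (f : bounded_op E F) :
  continuous f.
Proof.
apply: bounded_linear_continuous; have [M M0 fM] := bounded_op_le f.
rewrite /bounded_near; near=> A; apply/nbhs_ballP; exists 1 => //= x.
rewrite -ball_normE /= sub0r normrN => x1; rewrite (le_trans (fM x))//.
by rewrite (@le_trans _ _ M)// ?ler_piMr// ?ltW//; near: A; apply: nbhs_pinfty_gt;
  rewrite ger0_real.
Unshelve. all: by end_near. Qed.

Section dual_sequences.
Context (R : realType) (k : scalar_kind).
Local Notation K := (scalar_field R k).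

(** The terms of the expansion of [v] tend to 0, and the [g i] are bounded below because their
    images under [T] are. *)
Lemma coordinate_cvg0 (G F : completeNormedModType K) (g : nat -> G)
    (g' : nat -> dual G) (T : bounded_op G F) :
  unconditional_basis g -> coordinate_functionals g g' ->
  seminormalized (fun i => T (g i)) ->
  forall v, (fun i => g' i v) @ \oo --> (0 : K^o).
Proof.
move=> ug gg' [a [b [a0 Tg]]] v.
have [M M0 TM] := bounded_op_le T.
have Mp : 0 < M + 1 by rewrite ltr_wpDl.
have ga i : a / (M + 1) <= `|g i|.
  rewrite ler_pdivrMr// mulrC; case/andP: (Tg i) => aT _.
  rewrite (le_trans (ltW aT))// (le_trans (TM _))// ler_wpM2r// lerDl//.
have := cvg_series_cvg_0 (cvgP _ (basis_expansion ug gg' (v := v))).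
move=> /cvgr0Pnorm_lt h; apply/cvgr0Pnorm_lt => e e0.
have e1 : 0 < e * (a / (M + 1)) by rewrite mulr_gt0// divr_gt0.
apply: filterS (h _ e1) => i; rewrite normrZ => gi.
rewrite -(@ltr_pM2r _ (a / (M + 1))) ?divr_gt0//.
by apply: le_lt_trans gi; rewrite ler_wpM2l.
Qed.

(** A norm-null sequence has relatively compact range, so infinitely many [phi n] have norm at least
    some [e]. Each of them is at least [e / 2] in modulus somewhere on the unit ball, and rescaling
    makes the value 1. *)
Lemma not_precompact_normalized (E : normedModType K) (phi : nat -> dual E) :
  ~ precompact (range phi) ->
  exists (s : nat -> nat) (z : nat -> E) (B : K),
    [/\ injective s, forall n, `|z n| <= B & forall n, phi (s n) (z n) = 1].
Proof.
move=> npc.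
have : ~ phi @ \oo --> (0 : dual E).
  by move=> /precompact_cvg_range pc; apply: npc; apply: pc; exact: norm_hausdorff.
have [[e [e0 eN]]|h] := pselect (exists e : K, 0 < e /\ forall N, exists n, (N <= n)%N /\
    e <= `|phi n|); last first.
  move=> nc; exfalso; apply: nc; apply/cvgr0Pnorm_lt => e e0; apply: contrapT => en.
  apply: h; exists e; split=> // N; apply: contrapT => nN; apply: en.
  exists N => // n /= Nn; apply: contrapT => ne; apply: nN; exists n; split=> //.
  by apply: real_not_lt => //; rewrite gtr0_real.
move=> _; have /choice[h hP] := eN.
pose fix s n := if n is m.+1 then h (s m).+1 else h 0%N.
have se n : e <= `|phi (s n)| by case: n => [|n] /=; [case: (hP 0%N)|case: (hP (s n).+1)].
have smono : {homo s : m n / (m < n)%N}.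
  by apply: homo_ltn => [m n p|n]; [exact: ltn_trans|case: (hP (s n).+1)].
have sinj : injective s.
  by move=> m n smn; case: (ltngtP m n) => // /smono; rewrite smn ltnn.
have /choice[z zP] n : exists z : E, `|z| <= (e / 2)^-1 /\ phi (s n) z = 1.
  have [x [x1 xe]] : exists x, `|x| <= 1 /\ e / 2 <= `|phi (s n) x|.
    apply: contrapT => nx; have : `|phi (s n)| <= e / 2.
      apply: sup_norm_le => x x1; apply/ltW; apply: contrapT => xe; apply: nx.
      exists x; split=> //; apply: real_not_lt => //.
      by rewrite gtr0_real// divr_gt0.
    move=> /(le_trans (se n)); rewrite ler_pdivlMr// ger_pMr//.
    by rewrite lern1.
  have px0 : 0 < `|phi (s n) x| by rewrite (lt_le_trans _ xe)// divr_gt0.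
  exists ((phi (s n) x)^-1 *: x); split.
    rewrite normrZ normfV (@le_trans _ _ `|phi (s n) x|^-1)//.
      by rewrite ler_piMr// invr_ge0 ltW.
    by rewrite lef_pV2// posrE divr_gt0.
  by rewrite linearZ; apply: mulVf; rewrite -normr_gt0.
by exists s, z, (e / 2)^-1; split=> // n; case: (zP n).
Qed.

End dual_sequences.

(** * The weak topology *)

Section weak_topology.
Context (K : numFieldType) (E : normedModType K).

Lemma weak_continuous_functional (psi : dual E) :
  continuous (psi : weak_space E -> K^o).
Proof.
move=> x A nA; have : nbhs x `=>` nbhs (x : initial_topology (psi : E -> K^o)).
  exact: (proj1 (@cvg_sup E (dual E) (fun phi : dual E =>
    Topological.class (initial_topology (phi : E -> K^o))) (nbhs (x : weak_space E))
      x _) (fun _ h => h) psi).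
by apply; exact: initial_continuous.
Qed.

Lemma weak_cvgP (T : Type) (W : set_system T) (z : T -> E) (x : E) : Filter W ->
  (forall psi : dual E, (fun t => psi (z t)) @ W --> (psi x : K^o)) ->
  z @ W --> (x : weak_space E).
Proof.
move=> FW h; apply/cvg_sup => psi A.
rewrite nbhsE => - [_ [ [U oU <-] Ux] UA].
apply: filterS UA _; apply: (h psi); exact: open_nbhs_nbhs.
Qed.

Lemma weakly_continuous_cvg (F : normedModType K) (Q : E -> F) (T : Type)
    (W : set_system T) (z : T -> E) (x : E) (B : K) : Filter W ->
  weakly_continuous_on_bounded Q ->
  (forall t, `|z t| <= B) -> `|x| <= B ->
  (forall psi : dual E, (fun t => psi (z t)) @ W --> (psi x : K^o)) ->
  Q \o z @ W --> Q x.
Proof.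
move=> FW Qw zB xB zx.
pose D : set (weak_space E) := [set y : E | `|y| <= B].
have bD : bounded_set (D : set E).
  rewrite /bounded_set /bounded_near; near=> M => y /= yB.
  apply: (le_trans yB); near: M; apply: nbhs_pinfty_ge.
  by rewrite ger0_real// (le_trans _ xB).
have /subspace_continuousP/(_ x xB) Qx := Qw D bD.
apply: cvg_trans Qx => A /= QA.
have H := weak_cvgP FW zx QA; apply: (@filterS _ W FW _ _ _ H) => t; apply; exact: zB.
Unshelve. all: by end_near. Qed.

(** This covers the polynomials attached to a single basis index, which the projection must
    therefore fix. *)
Lemma functional_poly_weakly_continuous (F : normedModType K) (phi psi : dual E)
    (m : nat) (y : F) :
  weakly_continuous_on_bounded (fun x : E => (phi x ^+ m * psi x) *: y).
Proof.
move=> B _; apply: continuous_subspaceT => x.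
have cvgf (f : dual E) : f @ nbhs (x : weak_space E) --> (f x : K^o).
  exact: weak_continuous_functional.
have cvgX n : (fun y => phi y ^+ n) @ nbhs (x : weak_space E) --> (phi x ^+ n : K^o).
  elim: n => [|n IH]; first by under eq_fun do rewrite expr0; exact: cvg_cst.
  under eq_fun do rewrite exprS; rewrite exprS.
  exact: (@cvgM K (weak_space E) _ _ phi (fun y => phi y ^+ n) _ _ (cvgf phi) IH).
have FN : Filter (nbhs (x : weak_space E)) by exact: nbhs_filter.
exact: (@cvgZr_tmp K F _ _ FN _ _ y (cvgM (cvgX m) (cvgf psi))).
Qed.

End weak_topology.

(** * Polynomials built from a functional and an operator *)

Section functional_poly.
Context (K : numFieldType) (E F : normedModType K).
Context (phi : dual E) (L : bounded_op E F) (m : nat).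

Lemma functional_hpoly_subproof :
  (fun x : E => phi x ^+ m *: L x) \in @hpoly_pred K m.+1 E F.
Proof.
apply/asboolP; split.
  exists (fun x => (\prod_(j < m) phi (x (lift ord0 j))) *: L (x ord0)); last first.
    by move=> x; rewrite prodr_const card_ord.
  move=> x i a u v /=; have [j ->|->] := unliftP ord0 i.
    rewrite (negPf (neq_lift _ _)).
    have H w : \prod_(l < m) phi (if lift ord0 l == lift ord0 j then w
          else x (lift ord0 l))
        = phi w * \prod_(l < m | l != j) phi (x (lift ord0 l)).
      rewrite (bigD1 j)//= eqxx; congr (_ * _).
      by apply: eq_bigr => l lj; rewrite (inj_eq lift_inj) (negPf lj).
    by rewrite !H linearP mulrDl scalerDl scalerA mulrA.
  by rewrite linearP scalerDr !scalerA mulrC.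
move=> x; apply: cvgZ; last exact: bounded_op_continuous.
have FN : Filter (nbhs x) by exact: nbhs_filter.
have phix : phi @ x --> (phi x : K^o) by exact: bounded_op_continuous.
elim: m => [|n IH]; first by under eq_fun do rewrite expr0; exact: cvg_cst.
under eq_fun do rewrite exprS; rewrite exprS.
exact: (@cvgM K E _ _ phi (fun y => phi y ^+ n) _ _ phix IH).
Qed.

Definition functional_hpoly := HPoly functional_hpoly_subproof.

End functional_poly.

Lemma injective_cvg_infty (s : nat -> nat) : injective s -> s @ \oo --> \oo.
Proof.
move=> sinj A [N _ NA]; suff [n0 n0P] : exists n0, forall n, (n0 <= n)%N -> (N <= s n)%N.
  by exists n0 => // n /n0P/NA.
elim: N {NA} => [|N [n0 IH]]; first by exists 0%N.
have [[m sm]|h] := pselect (exists m, s m = N).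
  exists (maxn n0 m.+1) => n; rewrite geq_max => /andP[/IH Nn mn].
  by rewrite ltn_neqAle Nn andbT -sm; apply: contraTneq mn => /sinj ->; rewrite ltnn.
exists n0 => n /IH; rewrite leq_eqVlt => /predU1P[Nn|//].
by case: h; exists n.
Qed.

(** * The diagonal contradiction *)

Section diagonal.
Context (R : realType) (k : scalar_kind).
Local Notation K := (scalar_field R k).
Local Notation re_norm x := (scalar_re `|x|).

Lemma re_normD (E : normedModType K) (x y : E) : re_norm (x + y) <= re_norm x + re_norm y.
Proof. by rewrite -scalar_reD le_scalar_re// ler_normD. Qed.

Lemma re_normM (x y : K) : re_norm (x * y) = re_norm x * re_norm y.
Proof. by rewrite normrM -{1}(scalar_reKnorm x) scalar_re_injM. Qed.

Lemma cvg_re_norm_lt (E : normedModType K) (T : Type) (W : set_system T) (u : T -> E)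
    (l : E) (c : R) : Filter W -> u @ W --> l -> 0 < c ->
  \forall t \near W, re_norm (u t - l) < c.
Proof.
move=> FW /cvgrPdist_lt ul c0; have ic0 : 0 < scalar_inj k c.
  by rewrite lt0r scalar_inj_ge0 ltW// andbT; apply/eqP => /(congr1 (@scalar_re R k));
    rewrite scalar_reK scalar_re0 => c00; rewrite c00 ltxx in c0.
by apply: filterS (ul _ ic0) => t; rewrite distrC lt_scalar_inj ?normr_real.
Qed.

(** Both [psi (z i)] and [psi (z j)] tend to the same limit along [W]. The product filter lets the
    two indices vary independently, so that [j] can later be fixed before [i]. *)
Lemma ultra_difference_weak_cvg (E : normedModType K) (W : set_system nat)
    (z : nat -> E) (x : E) (B : K) (psi : dual E) :
  UltraFilter W -> (forall n, `|z n| <= B) ->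
  (fun ij => psi (x + (z ij.1 - z ij.2))) @ filter_prod W W --> (psi x : K^o).
Proof.
move=> UW zB; have [M M0 psiM] := bounded_op_le psi.
have [|l zl] := @scalar_ultra_cvg R k nat W (fun n => psi (z n)) (M * B) UW.
  by apply: nearW => n; rewrite (le_trans (psiM _))// ler_wpM2l.
rewrite -[X in _ --> X]addr0 -[X in _ + X](subrr l).
under eq_fun do rewrite linearD linearB.
apply: cvgD; first exact: cvg_cst.
by apply: cvgB; [apply: cvg_comp zl; exact: cvg_fst|apply: cvg_comp zl; exact: cvg_snd].
Qed.

(* The points [z i] need not have a weak cluster point in [E], but along an
   ultrafilter all functionals converge at them, so the differences
   [z i - z j] are weakly null. This replaces the theorem that polynomials
   weakly continuous on bounded sets are weakly uniformly continuous. *)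
Lemma no_weakly_continuous_diagonal (E F : normedModType K) (m : nat)
    (Q : E -> F) (f : nat -> F -> R) (M : R)
    (phi : dual E) (Phi : nat -> dual E) (x0 : E) (z : nat -> E) (B : K) :
  weakly_continuous_on_bounded Q ->
  (forall i u v, f i (u + v) = f i u + f i v) ->
  (forall i u, `|f i u| <= M * re_norm u) ->
  phi x0 = 1 -> (forall n, `|z n| <= B) -> (forall n, Phi n (z n) = 1) ->
  (forall x, (fun n => Phi n x) @ \oo --> (0 : K^o)) ->
  (forall n i j, f n (Q (x0 + (z i - z j))) =
    scalar_re (phi (x0 + (z i - z j)) ^+ m * Phi n (x0 + (z i - z j)))) ->
  False.
Proof.
(* The margins suffice because 1 - (1/4 + 1/16 + 1/4) - 1/16 = 3/8 exceeds 1/4. *)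
have arith (s p q n1 n2 n3 n4 n5 : R) : 1 + s - p <= 4^-1 -> - n1 <= s ->
    p <= q -> q < 16^-1 -> n1 <= n2 + n3 -> n3 <= n4 + n5 -> n4 <= 4^-1 * 4^-1 ->
    n5 < 4^-1 -> n2 < 4^-1 -> False by lra.
move=> Qw fD fM phix0 zB Phiz Phi0 fQ.
have [W [UW ooW]] := @ultraFilterLemma nat \oo _.
pose w (ij : nat * nat) := x0 + (z ij.1 - z ij.2).
have B0 : 0 <= B by exact: le_trans (zB 0%N).
have wB ij : `|w ij| <= `|x0| + (B + B).
  rewrite (le_trans (ler_normD _ _))// lerD2l (le_trans (ler_normB _ _))//.
  by rewrite lerD.
have x0B : `|x0| <= `|x0| + (B + B) by rewrite lerDl addr_ge0.
have wx0 psi := @ultra_difference_weak_cvg E W z x0 B psi UW zB.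
have FWW : Filter (filter_prod W W) by exact: filter_prod_filter.
have Qw0 := weakly_continuous_cvg FWW Qw wB x0B wx0.
have phi1 : (fun ij => phi (w ij) ^+ m) @ filter_prod W W --> (1 : K^o).
  rewrite -[X in _ --> X](expr1n _ m) -phix0.
  elim: (m) => [|n IH]; first by under eq_fun do rewrite expr0; exact: cvg_cst.
  under eq_fun do rewrite exprS; rewrite exprS.
  exact: (@cvgM K _ (filter_prod W W) _ (fun ij => phi (w ij))
    (fun ij => phi (w ij) ^+ n) _ _ (wx0 phi) IH).
(* Chosen so that [f i] moves by at most 1/4 between points at this distance. *)
have e1 : 0 < (4 * (`|M| + 1))^-1 :> R by rewrite invr_gt0 mulr_gt0// ltr_wpDl.
have e2 : 0 < 4^-1 :> R by rewrite invr_gt0.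
have e3 : 0 < 16^-1 :> R by rewrite invr_gt0.
have := filterI (cvg_re_norm_lt FWW Qw0 e1) (cvg_re_norm_lt _ phi1 e2).
move=> [[V1 V2] /= [WV1 WV2] V12].
(* With [j] fixed first, [x0] and [x0 - z j] are fixed points, where [Phi i] becomes small as [i]
   grows. *)
have [j V2j] := filter_ex WV2.
have W1 : W [set i | re_norm (Phi i x0 - 0 : K^o) < 16^-1].
  by apply: ooW; exact: cvg_re_norm_lt (Phi0 x0) e3.
have W2 : W [set i | re_norm (Phi i (x0 - z j) - 0 : K^o) < 4^-1].
  by apply: ooW; exact: cvg_re_norm_lt (Phi0 _) e2.
have [i [V1i [/= Px0 Pxz]]] := filter_ex (filterI WV1 (filterI W1 W2)).
have [/= Qclose phiclose] := V12 (i, j) (conj V1i V2j).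
rewrite !subr0 in Px0 Pxz.
have fw := fQ i i j; rewrite -/(w (i, j)) in fw.
(* Equal indices collapse the point to [x0], so the hypothesis also gives the [i]-th coordinate of
   [Q x0]. *)
have f0 := fQ i j j; rewrite subrr addr0 phix0 expr1n mul1r in f0.
have Pw : Phi i (w (i, j)) = 1 + Phi i (x0 - z j).
  by rewrite /w /= addrCA (linearD (Phi i) (z i)) -[X in X + _]/(Phi i (z i)) Phiz.
have f00 : f i 0 = 0 by apply: (addrI (f i 0)); rewrite -fD !addr0.
have fB : f i (Q (w (i, j)) - Q x0) = f i (Q (w (i, j))) - f i (Q x0).
  by apply: (addIr (f i (Q x0))); rewrite -fD !subrK.
have H1 : `|f i (Q (w (i, j))) - f i (Q x0)| <= 4^-1.
  rewrite -fB (le_trans (fM _ _))// (@le_trans _ _ ((`|M| + 1) * (4 * (`|M| + 1))^-1))//.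
    rewrite (@le_trans _ _ ((`|M| + 1) * re_norm (Q (w (i, j)) - Q x0)))//.
      apply: ler_wpM2r; first by rewrite -(scalar_re0 R k) le_scalar_re.
      by rewrite (le_trans (ler_norm M))// lerDl.
    by rewrite ler_wpM2l ?addr_ge0// ltW.
  by rewrite invfM mulrCA divff ?mulr1// gt_eqF// ltr_wpDl.
set b := phi (w (i, j)) ^+ m in fw phiclose.
set t := Phi i (x0 - z j) in Pw Pxz.
have bt : b * (1 + t) = 1 + ((b - 1) + ((b - 1) * t + t)) by ring.
have r1 := norm_scalar_re_le ((b - 1) + ((b - 1) * t + t)).
have r2 := re_normD (b - 1) ((b - 1) * t + t).
have r3 := re_normD ((b - 1) * t) t.
have r4 := norm_scalar_re_le (Phi i x0).
rewrite re_normM in r3.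
have r5 : re_norm (b - 1) * re_norm t <= 4^-1 * 4^-1.
  apply: ler_pM; rewrite ?(ltW Pxz) ?(ltW phiclose)//;
    by rewrite -(scalar_re0 R k) le_scalar_re.
rewrite Pw bt scalar_reD scalar_re1 in fw.
rewrite fw f0 in H1.
move: H1 r1 r4; rewrite !ler_norml => /andP[_ H1] /andP[r1 _] /andP[_ r4].
exact: (arith _ _ _ _ _ _ _ _ H1 r1 r4 Px0 r2 r3 r5 Pxz phiclose).
Qed.

End diagonal.

(** * Norm estimates and coordinates of the multipliers *)

Lemma bounded_op_comp_subproof (K : numFieldType) (E F G : normedModType K)
    (f : bounded_op F G) (h : bounded_op E F) :
  (fun x : E => f (h x)) \in @bounded_op_pred K E G.
Proof.
have [M M0 fM] := bounded_op_le f; have [N N0 hN] := bounded_op_le h.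
apply/asboolP; split; first by move=> a x y; rewrite !linearP.
by exists (M * N) => x; rewrite (le_trans (fM _))// -mulrA ler_wpM2l.
Qed.

Definition bounded_op_comp (K : numFieldType) (E F G : normedModType K)
    (f : bounded_op F G) (h : bounded_op E F) : bounded_op E G :=
  BoundedOp (bounded_op_comp_subproof f h).

Section operators.
Context (R : realType) (k : scalar_kind).
Local Notation K := (scalar_field R k).
Local Notation re_norm x := (scalar_re `|x|).

Lemma bounded_op_le_norm (E F : normedModType K) (f : bounded_op E F) x :
  `|f x| <= `|f| * `|x|.
Proof.
have [->|x0] := eqVneq x 0; first by rewrite linear0 !normr0 mulr0.
have nx0 : 0 < `|x| by rewrite normr_gt0.
rewrite -ler_pdivrMr// mulrC -[X in X * _]ger0_norm ?invr_ge0// -normrZ.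
have -> : `|x|^-1 *: f x = f (`|x|^-1 *: x) by rewrite linearZ.
change (`|f (`|x|^-1 *: x)| <= sup_norm f); apply: le_sup_norm.
  exact: bounded_op_bounded.
by rewrite normrZ normfV normr_id mulVf ?gt_eqF.
Qed.

Lemma hpoly_le_norm (n : nat) (E F : normedModType K) (Q : hpoly n E F) x :
  `|Q x| <= `|Q| * `|x| ^+ n.
Proof.
have [->|x0] := eqVneq x 0.
  rewrite -{1}(scale0r (0 : E)) hpolyZ normrZ normrX !normr0 mulrC.
  rewrite ler_wpM2r ?exprn_ge0//.
  change (`|Q 0| <= sup_norm Q); apply: le_sup_norm; first exact: hpoly_bounded.
  by rewrite normr0.
have nx0 : 0 < `|x| by rewrite normr_gt0.
rewrite -ler_pdivrMr ?exprn_gt0// mulrC -exprVn.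
rewrite -[X in X * _]ger0_norm ?exprn_ge0 ?invr_ge0// -normrZ -hpolyZ.
change (`|Q (`|x|^-1 *: x)| <= sup_norm Q).
apply: le_sup_norm; first exact: hpoly_bounded.
by rewrite normrZ normfV normr_id mulVf ?gt_eqF.
Qed.

Lemma functional_hpoly_norm_le (E F : normedModType K) (phi : dual E)
    (L : bounded_op E F) (m : nat) :
  `|functional_hpoly phi L m| <= `|phi| ^+ m * `|L|.
Proof.
apply: sup_norm_le => x x1 /=; rewrite normrZ normrX ler_pM ?exprn_ge0//.
  apply: lerXn2r; rewrite ?nnegrE//.
  by rewrite (le_trans (bounded_op_le_norm _ _))// ler_piMr.
by rewrite (le_trans (bounded_op_le_norm _ _))// ler_piMr.
Qed.

(** Past index [j] every partial sum has the stated value under [f], and continuity passes it to the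
    limit. The scalar [a] stays inside because [f] is only real-linear. *)
Lemma multiplier_functional (G F : completeNormedModType K) (g : nat -> G)
    (g' : nat -> dual G) (T : bounded_op G F) (A : set nat) (v w : G)
    (f : F -> R) (M : R) (j : nat) (a : K) :
  subseries g g' A v @ \oo --> w ->
  (forall x y, f (x + y) = f x + f y) ->
  (forall x, `|f x| <= M * re_norm x) ->
  (forall i b, f (b *: T (g i)) = if i == j then scalar_re b else 0) ->
  f (a *: T w) = scalar_re (a * (if `[< A j >] then g' j v else 0)).
Proof.
move=> Aw fD fM fg.
have f0 : f 0 = 0 by apply: (addrI (f 0)); rewrite -fD !addr0.
have fB x y : f (x - y) = f x - f y by apply: (addIr (f y)); rewrite -fD !subrK.
pose c i := if `[< A i >] then g' i v else 0.
have fS n : (j < n)%N -> f (a *: T (subseries g g' A v n)) = scalar_re (a * c j).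
  move=> jn; rewrite /subseries /series /= big_mkord linear_sum scaler_sumr.
  rewrite (big_morph f fD f0) (bigD1 (Ordinal jn))//= big1 => [|i ij].
    by rewrite linearZ /= scalerA fg eqxx addr0.
  by rewrite linearZ /= scalerA fg; move: ij; rewrite -val_eqE /= => /negPf ->.
apply/eqP; rewrite -subr_eq0 -normr_le0; apply/ler_addgt0Pr => e e0; rewrite add0r.
have TA : (fun n => a *: T (subseries g g' A v n)) @ \oo --> a *: T w.
  apply: cvgZl_tmp; apply: (cvg_comp _ _ Aw); exact: bounded_op_continuous.
have e1 : 0 < e / (`|M| + 1) by rewrite divr_gt0// ltr_wpDl.
have [n [ne jn]] := filter_ex (filterI (cvg_re_norm_lt _ TA e1) (nbhs_infty_gt j)).
rewrite -(fS n jn) distrC -fB (le_trans (fM _))//.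
have rn0 (x : F) : 0 <= re_norm x by have := le_scalar_re (normr_ge0 x);
  rewrite scalar_re0.
rewrite (@le_trans _ _ ((`|M| + 1) * (e / (`|M| + 1))))//; last first.
  by rewrite mulrC divfK// gt_eqF// ltr_wpDl.
rewrite (@le_trans _ _
  ((`|M| + 1) * re_norm (a *: T (subseries g g' A v n) - a *: T w)))//.
  by rewrite ler_wpM2r// (le_trans (ler_norm M))// lerDl.
by rewrite ler_wpM2l ?addr_ge0// ltW.
Qed.

Lemma multiplier_setU (G : completeNormedModType K) (g : nat -> G)
    (g' : nat -> dual G) (A B : set nat) (v wA wB wAB : G) :
  A `&` B = set0 ->
  subseries g g' A v @ \oo --> wA -> subseries g g' B v @ \oo --> wB ->
  subseries g g' (A `|` B) v @ \oo --> wAB -> wAB = wA + wB.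
Proof.
move=> AB cA cB cAB; apply: (cvg_unique _ cAB); first exact: norm_hausdorff.
rewrite (_ : subseries g g' (A `|` B) v = subseries g g' A v + subseries g g' B v).
  exact: cvgD.
apply/funext => n; rewrite /subseries fctE /series /= -big_split /=.
apply: eq_bigr => i _; rewrite -scalerDl; congr (_ *: _).
case: asboolP => [[Ai|Bi]|nAB].
- have nBi : ~ B i by move=> Bi; have : (A `&` B) i by []; rewrite AB.
  by rewrite (asboolT Ai) (asboolF nBi) addr0.
- have nAi : ~ A i by move=> Ai; have : (A `&` B) i by []; rewrite AB.
  by rewrite (asboolF nAi) (asboolT Bi) add0r.
- by rewrite !asboolF ?addr0// => ?; apply: nAB; [right|left].
Qed.

Lemma multiplier_set1 (G : completeNormedModType K) (g : nat -> G)
    (g' : nat -> dual G) (n : nat) (v w : G) :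
  subseries g g' [set n] v @ \oo --> w -> w = g' n v *: g n.
Proof.
move=> nw; apply: (cvg_unique _ nw); first exact: norm_hausdorff.
rewrite (_ : subseries g g' _ _ =
  series (fun i => (if i == n then g' n v else 0) *: g i)).
  exact: cvg_series_delta.
rewrite /subseries; congr series; apply/funext => i; congr (_ *: _).
have [->|ni] := eqVneq i n; first by rewrite asboolT.
by rewrite asboolF// => /= /eqP; rewrite (negPf ni).
Qed.

End operators.

Theorem theorem3p3 (R : realType) (k : scalar_kind)
    (E F G : completeNormedModType (scalar_field R k))
    (g : nat -> G) (g' : nat -> dual G) :
  unconditional_basis g -> coordinate_functionals g g' ->
  (exists (T : bounded_op G F) (S : bounded_op E G),
     [/\ basic_sequence (fun i => T (g i)),
         seminormalized (fun i => T (g i)) &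
         ~ precompact [set adjoint S (g' i) | i in [set: nat]] ]) ->
  forall n : nat, (1 <= n)%N -> ~ complemented (@hpoly_w _ n E F).
Proof.
move=> ug gg' [T [S [bT sT npc]]] [//|m] _ [p pp prange].
pose Phi i := adjoint S (g' i).
have [s [z [B [sinj zB Phiz]]]] := not_precompact_normalized npc.
have Phi0 x : (fun i => Phi i x) @ \oo --> (0 : (scalar_field R k)^o).
  exact: (coordinate_cvg0 ug gg' sT).
have [M [f fP]] := basic_sequence_functionals bT sT.
have fD j u v : f j (u + v) = f j u + f j v by case: (fP j).
have fM j u : `|f j u| <= M * scalar_re `|u| by case: (fP j).
have fg j i a : f j (a *: T (g i)) = if i == j then scalar_re a else 0.
  by case: (fP j).
have [C [P PP]] := basis_multipliers ug gg'.
have PC A v : `|P A v| <= C * `|v| by case: (PP A v).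
have Pcvg A v : subseries g g' A v @ \oo --> P A v by case: (PP A v).
(* This pair serves as the functional and base point with [phi x0 = 1]. *)
pose phi := Phi (s 0%N); pose x0 := z 0%N.
pose U A : hpoly m.+1 E F :=
  functional_hpoly phi (bounded_op_comp T (bounded_op_comp (P A) S)) m.
have UE A x : U A x = phi x ^+ m *: T (P A (S x)) by [].
(* The bound does not depend on [A], which makes the charges [mu j] bounded. *)
pose N := `|phi| ^+ m * (`|T| * (`|C| * `|S|)).
have UN A : `|U A| <= N.
  rewrite (le_trans (functional_hpoly_norm_le _ _ _))// ler_wpM2l ?exprn_ge0//.
  apply: sup_norm_le => x x1 /=.
  rewrite (le_trans (bounded_op_le_norm _ _))// ler_wpM2l//.
  have C0 : C * `|S x| <= `|C| * `|S x|.
    have := le_trans (normr_ge0 _) (PC A (S x)) => CS.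
    by rewrite -[leLHS]ger0_norm// normrM normr_id.
  rewrite (le_trans (PC _ _))// (le_trans C0)// ler_wpM2l//.
  by rewrite (le_trans (bounded_op_le_norm _ _))// ler_piMr.
have UU A A' : A `&` A' = set0 -> U (A `|` A') = U A + U A'.
  move=> AA; apply/val_inj/funext => x.
  change (U (A `|` A') x = U A x + U A' x).
  rewrite !UE (multiplier_setU AA (Pcvg A _) (Pcvg A' _) (Pcvg _ _)).
  by rewrite linearD scalerDr.
have p_id Q : hpoly_w Q -> p Q = Q by rewrite -prange => -[V _ <-].
(* For a singleton the polynomial is a scalar polynomial times [T (g n)], which is weakly continuous
   on bounded sets; hence [D] vanishes on singletons. *)
have U1 n : p (U [set n]) = U [set n].
  apply: p_id; change (weakly_continuous_on_bounded (hpoly_val (U [set n]))).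
  have -> : hpoly_val (U [set n]) = fun x => (phi x ^+ m * Phi n x) *: T (g n).
    by apply/funext => x; rewrite UE (multiplier_set1 (Pcvg _ _)) linearZ /= scalerA.
  exact: functional_poly_weakly_continuous.
(* An index [j] consists of a coordinate [j.1.1] of [F] and the labels [j.1.2] and [j.2] of two
   points, so there are countably many charges. *)
pose y (j : nat * nat * nat) := x0 + (z j.1.2 - z j.2).
pose D A := U A - p (U A).
have DU A A' : A `&` A' = set0 -> D (A `|` A') = D A + D A'.
  by move=> AA; rewrite /D UU// linearD opprD addrACA.
have D1 n : D [set n] = 0 by rewrite /D U1 subrr.
have f0 j : f j 0 = 0 by apply: (addrI (f j 0)); rewrite -fD !addr0.
have fB j u v : f j (u - v) = f j u - f j v.
  by apply: (addIr (f j v)); rewrite -fD !subrK.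
have disj A A' : A `&` A' = set0 -> [set s n | n in A] `&` [set s n | n in A'] = set0.
  move=> AA; apply/seteqP; split => // _ [[a Aa <-] [b A'b /sinj ba]].
  have : (A `&` A') a by split=> //; rewrite -ba.
  by rewrite AA.
(* Taking images under [s] keeps the set to be found among the indices that have a normalised
   point. *)
pose mu (j : nat * nat * nat) A := f j.1.1 (D [set s n | n in A] (y j)).
have [|||t tinj mut] := @charges_null_infinite_set R (nat * nat * nat)%type mu.
- move=> j A A' AA; rewrite /mu image_setU DU; last exact: disj.
  exact: fD.
- move=> j; exists (`|M| * scalar_re ((N + `|p| * N) * `|y j| ^+ m.+1)) => A.
  rewrite /mu (le_trans (fM _ _))// (@le_trans _ _
    (`|M| * scalar_re `|D [set s n | n in A] (y j)|))//.
    rewrite ler_wpM2r ?ler_norm//.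
    by have := le_scalar_re (normr_ge0 (D [set s n | n in A] (y j))); rewrite scalar_re0.
  rewrite ler_wpM2l//; apply: le_scalar_re;
    rewrite (le_trans (hpoly_le_norm _ _))// ler_wpM2r ?exprn_ge0//.
  rewrite (le_trans (ler_normB _ _))// lerD//.
  by rewrite (le_trans (bounded_op_le_norm _ _))// ler_wpM2l.
- by move=> j n; rewrite /mu image_set1 D1; exact: f0.
pose A := [set s n | n in range t].
have Qw : weakly_continuous_on_bounded (p (U A)).
  have : range p (p (U A)) by exists (U A).
  by rewrite prange.
apply: (@no_weakly_continuous_diagonal R k E F m (p (U A)) (fun n => f (s (t n))) M phi
  (fun n => Phi (s (t n))) x0 (fun n => z (t n)) B Qw) => //.
- exact: Phiz.
- by move=> n; exact: Phiz.
- move=> x; apply: (cvg_comp _ _ _ (Phi0 x)).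
  by apply: injective_cvg_infty => a b /sinj/tinj.
move=> n i j; set w := x0 + _.
(* The charge of [A] vanishes at this coordinate and point, so [p (U A)] may be replaced by [U A],
   whose coordinate is explicit because [s (t n)] belongs to [A]. *)
have : f (s (t n)) (U A w - p (U A) w) = 0 by exact: (mut (s (t n), t i, t j)).
rewrite fB => /eqP; rewrite subr_eq0 => /eqP <-.
rewrite UE (multiplier_functional _ (Pcvg A _) (fD _) (fM _) (fg _)).
by rewrite asboolT//; exists (t n) => //; exists n.
Qed.
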